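(* Assume the planar Furstenberg conjecture over prime fields (stated in the context) holds. Let $1\le k<n$ be integers, $a\in(0,n]$ and $s>0$ real. Then for every $c>0$ and every $\varepsilon>0$ there exist constants $C>0$ and $p_0$, depending only on $n,k,a,s,c,\varepsilon$, such that for every prime $p\ge p_0$ and every $A\subset\mathbb{F}_p^n$ with $\#A\ge c\,p^a$, $$\#E_{s-\varepsilon}(A;n,k)\le C\,p^{\varepsilon+\mathbf{M}(a,s;n,k)}.$$
   Context: $\mathbb{F}_p$ is the field with $p$ elements, $p$ prime. $G(m,\mathbb{F}_p^n)$ is the set of $m$-dimensional linear subspaces of $\mathbb{F}_p^n$. For $V\in G(m,\mathbb{F}_p^n)$ let $\pi_V^*(x)=x+V$ and $\pi_V^*(A)=\{x+V:x\in A\}$. For $A\subset\mathbb{F}_p^n$ and real $r$, $$E_r(A;n,k)=\{V\in G(n-k,\mathbb{F}_p^n):\#\pi_V^*(A)<p^r\}.$$ Planar Furstenberg conjecture over prime fields: for all $s\in(0,1]$, $t\in(0,2]$, $\lambda\in(0,1]$, $\varepsilon>0$ there is $c>0$ depending only on $s,t,\lambda,\varepsilon$ such that for every prime $p$: if $\mathcal{L}$ is a set of (affine) lines in $\mathbb{F}_p^2$ with $\#\mathcal{L}\ge\lambda p^t$ and for each $\ell\in\mathcal{L}$, $Y(\ell)\subset\ell$ has $\#Y(\ell)\ge\lambda p^s$, then $\#\bigcup_{\ell\in\mathcal{L}}Y(\ell)\ge c\,p^{\min\{s+t,\frac32 s+\frac12 t,s+1\}-\varepsilon}$. Marstrand index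 $\mathbf{M}(a,s;n,k)$ (integers $1\le k<n$, $a\in(0,n]$, $s>0$): write $a=m+\beta$, $s=l+\gamma$ with nonnegative integers $m,l$ and $\beta,\gamma\in(0,1]$ (unique). Then Type 1: if $s>\min\{a,k\}$, $\mathbf{M}(a,s;n,k)=k(n-k)$. Type 2: if $s\le\min\{a,k\}$, $l+1\le m\le n+l-k$ and $\gamma\in(\beta,1]$, $\mathbf{M}(a,s;n,k)=k(n-k)-(m-l)(k-l)+\max\{2\gamma-(\beta+1),0\}$. Type 3: if $s\le\min\{a,k\}$, $l\le m\le n+l-k-1$ and $\gamma\in(0,\beta]$, $\mathbf{M}(a,s;n,k)=k(n-k)-(m+1-l)(k-l)+\max\{2\gamma-\beta,0\}$. Type 4: if $s\le a-(n-k)$, $\mathbf{M}(a,s;n,k)=-\infty$. These types cover every $(a,s)$ exactly once. Convention: $p^{-\infty}=0$. *)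

(* Defs.v *)
From HB Require Import structures.
From mathcomp Require Import all_boot all_order all_algebra.
From mathcomp Require Import zify lra.
From mathcomp Require Import reals constructive_ereal exp.

Set Implicit Arguments.
Unset Strict Implicit.
Unset Printing Implicit Defensive.

Import Order.TTheory GRing.Theory Num.Theory.
Local Open Scope ring_scope.

(* The library stops at choiceType for subspaces; over a finite field there
   are finitely many of them, so they can be counted with #|_|. *)
Section FiniteSubspaces.
Import VectorInternalTheory.
Variables (F : finFieldType) (vT : vectType F).
HB.instance Definition _ := [Countable of {vspace vT} by <:].
HB.instance Definition _ := [Finite of {vspace vT} by <:].
End FiniteSubspaces.

Section Geometry.
Variables (F : finFieldType) (n : nat).

Definition grassmannian (m : nat) : {set {vspace 'rV[F]_n}} :=
  [set V | \dim V == m].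

Definition coset (V : {vspace 'rV[F]_n}) (x : 'rV[F]_n) : {set 'rV[F]_n} :=
  [set x + v | v in V].

(* The projection of A along V, as a subset of the quotient F^n / V. *)
Definition projection (V : {vspace 'rV[F]_n}) (A : {set 'rV[F]_n}) :
    {set {set 'rV[F]_n}} :=
  [set coset V x | x in A].

Definition is_line (l : {set 'rV[F]_n}) : Prop :=
  exists (V : {vspace 'rV[F]_n}) (x : 'rV[F]_n),
    V \in grassmannian 1 /\ l = coset V x.

End Geometry.

Definition exceptional (R : realType) (p n k : nat) (r : R)
    (A : {set 'rV['F_p]_n}) : {set {vspace 'rV['F_p]_n}} :=
  [set V in grassmannian 'F_p n (n - k) |
    #|projection V A|%:R < p%:R `^ r].

Definition planar_furstenberg_conjecture (R : realType) : Prop :=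
  forall s t lam eps : R,
    0 < s <= 1 -> 0 < t <= 2 -> 0 < lam <= 1 -> 0 < eps ->
  exists2 c : R, 0 < c &
  forall p : nat, prime p ->
  forall (L : {set {set 'rV['F_p]_2}})
         (Y : {set 'rV['F_p]_2} -> {set 'rV['F_p]_2}),
    (forall l, l \in L -> is_line l) ->
    lam * p%:R `^ t <= #|L|%:R ->
    (forall l, l \in L -> Y l \subset l /\ lam * p%:R `^ s <= #|Y l|%:R) ->
  c * p%:R `^ (Num.min (s + t)
                 (Num.min (3 / 2 * s + 1 / 2 * t) (s + 1)) - eps)
    <= #|\bigcup_(l in L) Y l|%:R.

Section Marstrand.
Variable R : realType.
Implicit Types (a s x : R) (n k : nat).

(* x = ipart x + fpart x with fpart x in (0, 1], as opposed to [0, 1);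
   see ipart_unique. *)
Definition ipart x : int := Num.ceil x - 1.
Definition fpart x : R := x - (ipart x)%:~R.

Lemma fpart_itv x : 0 < fpart x <= 1.
Proof.
have /andP[] := ceil_itv x; rewrite /fpart /ipart !rmorphB /=; lra.
Qed.

Lemma ipart_unique (m : nat) (b : R) :
  0 < b <= 1 -> ipart (m%:R + b) = m /\ fpart (m%:R + b) = b.
Proof.
move=> hb; have im : ipart (m%:R + b) = m.
  rewrite /ipart (@ceil_def _ _ (m%:Z + 1)) ?addrK //.
  by rewrite rmorphD /= -pmulrn; lra.
by rewrite /fpart im -pmulrn addrAC subrr add0r.
Qed.

(* The branches are types 1 to 4 in this order. For 0 < a <= n, 0 < s and
   k < n the last one is exactly s <= a - (n - k); see marstrand_eqNy. *)
Definition marstrand a s n k : \bar R :=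
  let m := ipart a in let beta := fpart a in
  let l := ipart s in let gamma := fpart s in
  let N : int := n in let K : int := k in
  if Num.min a k%:R < s then ((K * (N - K))%:~R)%:E
  else if [&& l + 1 <= m, m <= N + l - K & beta < gamma] then
    ((K * (N - K) - (m - l) * (K - l))%:~R
       + Num.max (2 * gamma - (beta + 1)) 0)%:E
  else if [&& l <= m, m <= N + l - K - 1 & gamma <= beta] then
    ((K * (N - K) - (m + 1 - l) * (K - l))%:~R
       + Num.max (2 * gamma - beta) 0)%:E
  else -oo%E.

Lemma marstrand_eqNy a s n k : 0 < a <= n%:R -> 0 < s -> (k < n)%N ->
  (marstrand a s n k == -oo%E) = (s <= a - (n - k)%:R).
Proof.
move=> ha hs hkn; rewrite /marstrand natrB 1?ltnW //.
have hkn' : k%:R < n%:R :> R by rewrite ltr_nat.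
have /andP[b0 b1] := fpart_itv a; have /andP[g0 g1] := fpart_itv s.
have ea : a = (ipart a)%:~R + fpart a by rewrite addrC subrK.
have es : s = (ipart s)%:~R + fpart s by rewrite addrC subrK.
set m := ipart a in ea *; set l := ipart s in es *.
set b := fpart a in ea b0 b1 *; set g := fpart s in es g0 g1 *.
clearbody m l b g.
case: ltP => [|]; rewrite (gt_min, le_min).
  by move=> h; apply/esym/negbTE; rewrite -ltNge; case/orP: h => h; lra.
case/andP=> hsa hsk.
have D : (m - l - (n%:Z - k%:Z))%:~R = m%:~R - l%:~R - (n%:R - k%:R) :> R.
  by rewrite !(rmorphD, rmorphN) /= -!pmulrn.
have hml0 : g <= b -> l <= m.
  by move=> h; rewrite -ltzD1 -(ltr_int R) rmorphD /=; lra.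
have hml1 : b < g -> l + 1 <= m.
  by move=> h; rewrite lezD1 -(ltr_int R); lra.
case: (ltP b g) => hbg.
  rewrite hml1 //= andbT !andbF; case: ifPn => hm; apply/esym.
    have : m - l - (n%:Z - k%:Z) <= 0 by clear -hm; lia.
    by rewrite -(ler_int R) D => ?; apply/negbTE; rewrite -ltNge; lra.
  have : 1 <= m - l - (n%:Z - k%:Z) by clear -hm; lia.
  by rewrite -(ler_int R) D eqxx => ?; lra.
rewrite hml0 //= !andbF andbT; case: ifPn => hm; apply/esym.
  have : m - l - (n%:Z - k%:Z) <= -1 by clear -hm; lia.
  by rewrite -(ler_int R) D => ?; apply/negbTE; rewrite -ltNge; lra.
have : 0 <= m - l - (n%:Z - k%:Z) by clear -hm; lia.
by rewrite -(ler_int R) D eqxx => ?; lra.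
Qed.

(* poweR extends the base of a power to \bar R; here it is the exponent, with
   x ^ -oo = 0. *)
Definition powRe x (e : \bar R) : \bar R :=
  match e with
  | r%:E => (x `^ r)%:E
  | +oo => +oo
  | -oo => 0
  end%E.

End Marstrand.

(* Main.v *)
Require Import Defs.
From mathcomp Require Import all_boot all_order all_algebra all_field.
From mathcomp Require Import zify ring lra.
From mathcomp Require Import reals constructive_ereal exp.

(** Point-line duality turns the planar Furstenberg conjecture into the case
   [n = 2], [k = 1] of the theorem ([planar_bound]): a planar set of size [p^a]
   can project to size [p^s], [s < min(a, 1)], along at most [p^u] directions
   with [u] close to [max(2 s - a, 0)].  The general case is reduced to this one
   through hyperplane sections and quotients by lines.

   Let [N = n - k] be the dimension of the subspaces [V].  There are four
   reductions, each of which lowers [n] by one and averages over a nonzero vector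
   that is used as a functional [f] or as a direction [v]:
   - [step_slice_containing]: [f] vanishes on [V]; [A] is replaced by its slice by
     a translate of [ker f].  This turns [(a, s)] into [(a - 1, s - 1)], keeps [N]
     and retains a [p^-N] fraction of the subspaces.
   - [step_project_inside]: [v] lies in [V]; [A] and [V] are projected along [v].
     This keeps [(a, s)] and [k], and retains a [p^-k] fraction of the subspaces.
   - [step_slice_generic]: [f] is arbitrary, [V] is replaced by its trace on
     [ker f]; this turns [(a, s)] into [(a - 1, s)] and keeps [k].
   - [step_project_generic]: [v] is arbitrary, [V] is replaced by [V + <v>];
     this keeps [(a, s)] and [N].
   The last two lose almost no subspaces as long as there are fewer than [p] of
   them.  Write [s = l + gamma] and [a = m + b], with [m] and [b] as in
   [exceptional_bound_nontrivial] so that [gamma <= min(b, 1)] and [b <= 2].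
   Performing the reductions [l], [N - 1 - (m - l)], [m - l] and [k - l - 1]
   times, in this order, leads to the plane with [(b, gamma)], and the costs
   [l N] and [(k - l) (N - 1 - (m - l))] of the first two, added to the planar
   exponent [max(2 gamma - b, 0)], make up the Marstrand index.

   In the last two reductions a second moment over the random vector controls [A]
   and the subspaces at the same time.  In the first two the vector is tied to
   [V], and the second moment fails if much of [A] lies on few cosets of [V].
   This is why the statement proved by induction is about shadings: each [V] comes
   with its own dense part [Y] of [A], and only [Y] has a small projection.
   Either half of [Y] lies on few cosets of [V], so that [V] is exceptional for a
   much smaller [s], a case settled by the later reductions alone; or the other
   half of [Y] can be kept, and the second moment is fine
   ([concentrated_or_spread]).  The planar conjecture tolerates shadings, since a
   dense shading still marks many points on most of the dual lines.

   All sizes are meant up to a factor [p^delta], which absorbs constants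
   ([exceptional_bound]).  If [s <= a - N] no subspace is exceptional, because
   cosets have [p^N] points; if [s > min(a, k)] the bound is the number of all
   subspaces ([card_grassmannian]). *)

Set Implicit Arguments.
Unset Strict Implicit.
Unset Printing Implicit Defensive.

Import Order.TTheory GRing.Theory Num.Theory.
Local Open Scope ring_scope.

(** * Second moments *)

Section Fibers.
Variables (R : realFieldType) (T T' : finType).
Implicit Types (A B : {set T}) (g : T -> T').

Definition fiber g A x := [set y in A | g y == g x].

(** The second moment of the sizes of the fibres. *)
Definition collisions g A : R := \sum_(x in A) #|fiber g A x|%:R.

Lemma sum_card_fiber g A :
  \sum_(y in g @: A) #|[set x in A | g x == y]|%:R = #|A|%:R :> R.
Proof.
rewrite -[in RHS]sum1_card natr_sum (partition_big_imset g) /=.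
apply: eq_bigr => y _; rewrite -sum1_card natr_sum.
by apply: eq_bigl => x; rewrite inE.
Qed.

Lemma collisionsE g A :
  collisions g A = \sum_(y in g @: A) #|[set x in A | g x == y]|%:R ^+ 2.
Proof.
rewrite /collisions (partition_big_imset g) /=; apply: eq_bigr => y _.
rewrite (eq_bigr (fun=> #|[set x in A | g x == y]|%:R)); last first.
  by move=> x /andP[_ /eqP <-].
rewrite sumr_const expr2 -[LHS]mulr_natr; congr (_ * _).
by congr _%:R; apply: eq_card => x; rewrite inE.
Qed.

Lemma collisions_ge0 g A : 0 <= collisions g A.
Proof. by apply: sumr_ge0 => x _; rewrite ler0n. Qed.

Lemma collisionsS g A B : A \subset B -> collisions g A <= collisions g B.
Proof.
move=> sAB; rewrite /collisions (big_setID A (A := B)) /= (setIidPr sAB).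
apply: ler_wpDr; first by apply: sumr_ge0 => x _; rewrite ler0n.
apply: ler_sum => x _; rewrite ler_nat subset_leq_card //.
by apply/subsetP => y; rewrite !inE => /andP[/(subsetP sAB) -> ->].
Qed.

(** Few collisions force many values. *)
Lemma cauchy_schwarz_fibers g A :
  #|A|%:R ^+ 2 <= #|g @: A|%:R * collisions g A.
Proof.
rewrite collisionsE -(sum_card_fiber g).
pose w y := #|[set x in A | g x == y]|%:R : R.
pose m : R := #|g @: A|%:R; pose S := \sum_(y in g @: A) w y.
change (S ^+ 2 <= m * \sum_(y in g @: A) w y ^+ 2).
have : 0 <= \sum_(y in g @: A) (m * w y - S) ^+ 2.
  by apply: sumr_ge0 => y _; apply: sqr_ge0.
have -> : \sum_(y in g @: A) (m * w y - S) ^+ 2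
    = m ^+ 2 * (\sum_(y in g @: A) w y ^+ 2) - m * S ^+ 2.
  transitivity (\sum_(y in g @: A)
      (m ^+ 2 * w y ^+ 2 - (2 * S * m) * w y + S ^+ 2)).
    by apply: eq_bigr => y _; ring.
  rewrite !big_split /= sumrN -!mulr_sumr sumr_const -/S -[_ *+ #|_|]mulr_natr -/m.
  ring.
move=> h.
have [m0|] := eqVneq m 0.
  move: h m0; rewrite /m /S => _ /eqP; rewrite pnatr_eq0 cards_eq0 => /eqP h.
  by rewrite h !big_set0 cards0 expr0n mul0r.
rewrite pnatr_eq0 -lt0n -(ltr0n R) -/m => m_gt0.
by rewrite -(ler_pM2l m_gt0); lra.
Qed.

Lemma card_heavy g A (t : R) :
  t * #|g @: [set x in A | t < #|fiber g A x|%:R]|%:R <= #|A|%:R.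
Proof.
set B := [set x in A | _].
rewrite -(sum_card_fiber g) mulr_natr -sumr_const.
have sBA : g @: B \subset g @: A by apply/imsetS/subsetP => x; case/setIdP.
rewrite [leRHS](big_setID (g @: B)) /= (setIidPr sBA).
apply: ler_wpDr; first by apply: sumr_ge0 => x _; rewrite ler0n.
by apply: ler_sum => y /imsetP[x]; case/setIdP => xA /ltW tx ->.
Qed.

Lemma collisions_light g A (t : R) :
  collisions g [set x in A | #|fiber g A x|%:R <= t]
    <= t * #|[set x in A | #|fiber g A x|%:R <= t]|%:R.
Proof.
set B := [set x in A | _]; rewrite mulr_natr -sumr_const.
apply: ler_sum => x /setIdP[_]; apply: le_trans.
rewrite ler_nat subset_leq_card //; apply/subsetP => y.
by case/setIdP => /setIdP[yA _] e; apply/setIdP.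
Qed.

End Fibers.

Section Moments.
Variable R : realFieldType.

Lemma collisions_id (T : finType) (A : {set T}) :
  collisions R id A = #|A|%:R.
Proof.
rewrite /collisions (eq_bigr (fun=> 1)) ?sumr_const // => x xA.
rewrite (_ : fiber _ _ _ = [set x]) ?cards1 //.
by apply/setP => y; rewrite !inE andb_idl // => /eqP ->.
Qed.

Lemma collisions_const (T : finType) (A : {set T}) :
  collisions R (fun=> tt) A = #|A|%:R ^+ 2.
Proof.
rewrite /collisions (eq_bigr (fun=> #|A|%:R)).
  by rewrite sumr_const expr2 mulr_natr.
move=> x xA; congr _%:R; apply: eq_card => y.
by rewrite inE eqxx andbT.
Qed.

(** The expected number of collisions under a random map [g s] is controlled as
   soon as the probability that [g s] identifies [x] and [y] only depends on
   whether two fixed maps do. *)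
Lemma sum_collisions (Q T T0 T1 T2 : finType) (S : {set Q}) (A : {set T})
    (g : Q -> T -> T2) (g0 : T -> T0) (g1 : T -> T1) (B0 B1 : R) :
  {in A &, forall x y, #|[set s in S | g s x == g s y]|%:R
     <= B0 * (g0 x == g0 y)%:R + B1 * (g1 x == g1 y)%:R} ->
  \sum_(s in S) collisions R (g s) A
    <= B0 * collisions R g0 A + B1 * collisions R g1 A.
Proof.
have cE (T' : finType) (h : T -> T') : collisions R h A =
    \sum_(x in A) \sum_(y in A) (h x == h y)%:R.
  apply: eq_bigr => x _; rewrite -sum1dep_card natr_sum big_mkcondr /=.
  by apply: eq_bigr => y _; rewrite eq_sym; case: eqP.
move=> h; rewrite !cE !mulr_sumr -big_split /=.
under eq_bigr do rewrite cE.
rewrite exchange_big /=; apply: ler_sum => x xA.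
rewrite exchange_big !mulr_sumr -big_split /=; apply: ler_sum => y yA.
apply: le_trans (h x y xA yA); rewrite -sum1dep_card natr_sum big_mkcondr /=.
by apply: ler_sum => s _; case: eqP.
Qed.

Lemma collisions_eq (T T1 T2 : finType) (g1 : T -> T1)
    (g2 : T -> T2) (A : {set T}) :
  (forall x y, (g1 x == g1 y) = (g2 x == g2 y)) ->
  collisions R g1 A = collisions R g2 A.
Proof.
move=> e; apply: eq_bigr => x _; congr _%:R; apply: eq_card => y.
by rewrite !inE e.
Qed.

End Moments.

(** * Averaging *)

Section Averaging.
Variables (R : realFieldType) (T I : finType).
Implicit Types (S : {set T}) (E : {set I}).

Lemma markov S (X : T -> R) (m t : R) :
  (forall s, s \in S -> 0 <= X s) -> 0 < t ->
  \sum_(s in S) X s <= #|S|%:R * m ->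
  t * #|[set s in S | t * m < X s]|%:R <= #|S|%:R.
Proof.
move=> X0 t0 hS; set B := [set s in S | _].
have sB : B \subset S by apply/subsetP => s; case/setIdP.
have [S0|/set0Pn[s sS]] := eqVneq S set0.
  by rewrite /B S0 (_ : [set _ in _ | _] = set0) ?cards0 ?mulr0 //;
    apply/setP => x; rewrite !inE.
have S0 : 0 < #|S|%:R :> R by rewrite ltr0n card_gt0; apply/set0Pn; exists s.
have le0 : 0 <= \sum_(s in S) X s by apply: sumr_ge0.
have m0 : 0 <= m by rewrite -(pmulr_rge0 _ S0); apply: le_trans hS.
have leB : \sum_(s in B) X s <= #|S|%:R * m.
  apply: le_trans hS; rewrite [leRHS](big_setID B) /= (setIidPr sB).
  by apply: ler_wpDr => //; apply: sumr_ge0 => x /setDP[xS _]; apply: X0.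
have [mE|mN] := eqVneq m 0.
  suff -> : B = set0 by rewrite cards0 mulr0.
  apply/setP => x; rewrite !inE mE mulr0; apply/negP => /andP[xS Xx].
  suff : X x <= 0 by rewrite leNgt Xx.
  rewrite (le_trans _ (le_trans hS _)) ?mE ?mulr0 //.
  rewrite (bigD1 x) //=; apply: ler_wpDr => //.
  by apply: sumr_ge0 => y /andP[yS _]; apply: X0.
have {}m0 : 0 < m by rewrite lt_def mN.
rewrite -(ler_pM2r m0); apply: le_trans leB.
rewrite mulrAC mulr_natr -sumr_const.
by apply: ler_sum => x /setIdP[_ /ltW].
Qed.

(** The mean over [S] of the number of indices related to [s] is at least
   [h * #|E| / #|S|]. *)
Lemma pigeonhole S E (r : I -> T -> bool) (h : R) : S != set0 ->
  (forall i, i \in E -> h <= #|[set s in S | r i s]|%:R) ->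
  exists2 s, s \in S & h * #|E|%:R <= #|S|%:R * #|[set i in E | r i s]|%:R.
Proof.
case/set0Pn => s0 s0S hE; apply/exists_inP; apply: contraT.
rewrite negb_exists_in => /forall_inP hN.
have S0 : 0 < #|S|%:R :> R by rewrite ltr0n card_gt0; apply/set0Pn; exists s0.
suff : h * #|E|%:R < h * #|E|%:R by rewrite ltxx.
have e : \sum_(i in E) #|[set s in S | r i s]|%:R =
    \sum_(s in S) #|[set i in E | r i s]|%:R :> R.
  under eq_bigr => i _ do rewrite -sum1dep_card natr_sum.
  under [RHS]eq_bigr => i _ do rewrite -sum1dep_card natr_sum.
  rewrite (exchange_big_dep (mem S)) /=; last by move=> i s _ /andP[].
  by apply: eq_bigr => s sS; apply: eq_bigl => i; rewrite sS.
have eE : \sum_(i in E) h = h * #|E|%:R by rewrite sumr_const mulr_natr.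
rewrite -{1}eE.
apply: (@le_lt_trans _ _ (\sum_(s in S) #|[set i in E | r i s]|%:R)).
  by rewrite -e; apply: ler_sum.
have eS : \sum_(s in S) h * #|E|%:R = #|S|%:R * (h * #|E|%:R).
  by rewrite sumr_const mulr_natl.
rewrite -(ltr_pM2l S0) mulr_sumr -eS.
apply: ltr_sum => [|s /hN]; last by rewrite -ltNge.
by apply/hasP; exists s0; rewrite ?mem_index_enum.
Qed.

End Averaging.

Lemma transversal_imset (I T : finType) (h : I -> T) (E : {set I}) :
  exists E' : {set I},
    [/\ E' \subset E, {in E' &, injective h} & #|E'| = #|h @: E|].
Proof.
pose rep i := odflt i [pick j in E | h j == h i].
have repP i : i \in E -> rep i \in E /\ h (rep i) = h i.
  rewrite /rep => iE; case: pickP => [j /andP[-> /eqP ->]|/(_ i)] //=.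
have repE i j : i \in E -> h i = h j -> rep i = rep j.
  move=> iE; rewrite /rep => <-; case: pickP => // /(_ i).
  by rewrite iE eqxx.
exists (rep @: E); split.
- by apply/subsetP => _ /imsetP[i /repP[? _] ->].
- move=> _ _ /imsetP[i iE ->] /imsetP[j jE ->].
  by have [[_ ->] [_ ->]] := (repP i iE, repP j jE); apply: repE.
rewrite -(card_in_imset (_ : {in rep @: E &, injective h})); last first.
  move=> _ _ /imsetP[i iE ->] /imsetP[j jE ->].
  by have [[_ ->] [_ ->]] := (repP i iE, repP j jE); apply: repE.
rewrite -imset_comp; congr #|pred_of_set _|; apply: eq_in_imset => i iE /=.
by have [] := repP i iE.
Qed.

Section Slicing.
Variable R : realFieldType.

(** As [Y i] has few collisions, it has little mass on the fibres of [A] that are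
   much larger than average; few fibres have a large cost [r i], and those that
   [Y i] fills thinly carry little of it in total.  A positive proportion of
   [Y i] remains, so many fibres are good for [i], and some fibre is good for
   many indices. *)
Lemma average_slice (T J I : finType) (g : T -> J) (A : {set T})
    (E : {set I}) (Y : I -> {set T}) (r : I -> J -> R) (C Q cost : R) :
  A != set0 -> E != set0 -> 1 <= C -> 1 <= Q -> 0 < cost ->
  (forall i, i \in E -> [/\ Y i \subset A, #|A|%:R <= Q * #|Y i|%:R,
     #|J|%:R * collisions R g (Y i) <= C * #|A|%:R ^+ 2,
     forall j, 0 <= r i j & \sum_j r i j <= #|J|%:R * (Q * cost)]) ->
  let Q' := 64 * C * Q ^+ 4 in
  exists j, exists2 E' : {set I}, E' \subset E &
    let Aj := [set x in A | g x == j] in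
    [/\ #|E|%:R <= Q' * #|E'|%:R, #|J|%:R * #|Aj|%:R <= Q' * #|A|%:R,
        #|A|%:R <= Q' * (#|J|%:R * #|Aj|%:R)
      & forall i, i \in E' ->
          #|Aj|%:R <= Q' * #|Y i :&: Aj|%:R /\ r i j <= Q' * cost].
Proof.
move=> A0 E0 C1 Q1 cost0 hE Q'.
have a0 : 0 < #|A|%:R :> R by rewrite ltr0n card_gt0.
have p0 : 0 < #|J|%:R :> R.
  by rewrite ltr0n; case/set0Pn: A0 => x _; apply/card_gt0P; exists (g x).
(* [t] times the average size is the bound above which a fibre of [A] is heavy;
   with this value the heavy fibres carry at most a quarter of each [Y i]. *)
have [t tE] : exists t, t = 16 * C * Q ^+ 2 by exists (16 * C * Q ^+ 2).
have [a aE] : exists a : R, a = #|A|%:R by exists #|A|%:R.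
have [p pE] : exists p : R, p = #|J|%:R by exists #|J|%:R.
rewrite -?aE -?pE in a0 p0 *.
have Q2 : 1 <= Q ^+ 2 by rewrite exprn_ege1.
have t0 : 16 <= t by rewrite tE; nra.
have tp : 0 < t by lra.
have t_ge0 := ltW tp.
have Qp : 0 < Q by lra.
have Q_ge0 := ltW Qp.
pose sl (X : {set T}) j := #|[set x in X | g x == j]|%:R : R.
have sl_sum X : \sum_j sl X j = #|X|%:R.
  rewrite /sl -sum1_card natr_sum (partition_big g xpredT) //=.
  by apply: eq_bigr => j _; rewrite -sum1dep_card natr_sum.
pose good i j := [&& p * sl A j <= t * a, #|Y i|%:R <= 4 * p * sl (Y i) j
   & r i j <= 4 * Q * t * (Q * cost)].
have /pigeonhole H : forall i, i \in E ->
    p / (4 * Q * t) <= #|[set j in [set: J] | good i j]|%:R.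
  move=> i /hE[]; rewrite -aE -pE => YA aY hc r0 hr.
  have [y yE] : exists y : R, y = #|Y i|%:R by exists #|Y i|%:R.
  rewrite -yE in aY.
  have y0 : 0 < y by nra.
  pose J1 := [set j in [set: J] | t * (a / p) < sl A j].
  pose J3 := [set j in [set: J] | 4 * Q * t * (Q * cost) < r i j].
  have hJ1 : t * #|J1|%:R <= p.
    have := @markov R J [set: J] (sl A) (a / p) t; rewrite cardsT -pE; apply.
    - by move=> s _; rewrite ler0n.
    - lra.
    - rewrite mulrCA divff ?lt0r_neq0 // mulr1 aE -sl_sum.
      by rewrite (eq_bigl xpredT) // => s; rewrite inE.
  have hJ3 : 4 * Q * t * #|J3|%:R <= p.
    have := @markov R J [set: J] (r i) (Q * cost) (4 * Q * t).
    rewrite cardsT -pE; apply => //; first by rewrite !mulr_gt0 //; lra.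
    rewrite (eq_bigl xpredT) => [|s]; last by rewrite inE.
    exact: hr.
  set G := [set j in _ | good i j].
  pose B := [set x in Y i | g x \in J1].
  have hB : #|B|%:R <= y / 4.
    have sB : B \subset Y i by apply/subsetP => x; case/setIdP.
    have : #|B|%:R ^+ 2 <= #|J1|%:R * collisions R g (Y i).
      apply: le_trans (cauchy_schwarz_fibers R g B) _.
      apply: ler_pM; rewrite ?ler0n ?collisions_ge0 //; last exact: collisionsS.
      rewrite ler_nat subset_leq_card //.
      by apply/subsetP => _ /imsetP[x /setIdP[_ ?] ->].
    have c0 := collisions_ge0 R g (Y i); have b0 : 0 <= #|B|%:R :> R by [].
    move: hJ1 hc => h1 h2 h3.
    rewrite -(ler_pXn2r (ltn0Sn 1)) ?nnegrE ?divr_ge0 ?(ltW y0) //.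
    have h4 : t * #|B|%:R ^+ 2 <= C * a ^+ 2.
      apply: le_trans h2.
      apply: le_trans (_ : t * (#|J1|%:R * collisions R g (Y i)) <= _).
        exact: ler_wpM2l.
      by rewrite mulrA ler_wpM2r.
    have h5 : a ^+ 2 <= Q ^+ 2 * y ^+ 2.
      by rewrite -exprMn lerXn2r ?nnegrE ?mulr_ge0 ?(ltW a0) ?(ltW y0).
    have h6 : t * #|B|%:R ^+ 2 <= t * (y / 4) ^+ 2.
      apply: (le_trans h4); rewrite tE expr_div_n.
      have : 0 <= C * (Q ^+ 2 * y ^+ 2 - a ^+ 2) by apply: mulr_ge0; lra.
      by lra.
    by rewrite -(ler_pM2l (_ : 0 < t)) //; lra.
  have BE : #|B|%:R = \sum_j (j \in J1)%:R * sl (Y i) j.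
    rewrite -sl_sum; apply: eq_bigr => j _; rewrite /sl.
    case: (boolP (j \in J1)) => jJ; rewrite ?mul1r ?mul0r.
      congr _%:R; apply: eq_card => x; apply/setIdP/setIdP => -[].
        by case/setIdP.
      by move=> xY /eqP e; split; rewrite ?e //; apply/setIdP; rewrite e.
    rewrite (_ : [set x in B | _] = set0) ?cards0 //; apply/setP => x.
    rewrite [RHS]inE; apply/negP => /setIdP[/setIdP[_ gJ] /eqP e].
    by rewrite -e gJ in jJ.
  (* [J1]: heavy fibres; [J3]: fibres of high cost; the third term bounds the
     fibres that [Y i] fills thinly; [G]: good fibres. *)
  have pw j : sl (Y i) j <= (j \in J1)%:R * sl (Y i) j
      + (j \in J3)%:R * (t * (a / p)) + y / (4 * p)
      + (j \in G)%:R * (t * (a / p)).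
    have s0 : 0 <= sl (Y i) j by rewrite ler0n.
    have d0 : 0 <= a / p by apply: divr_ge0; apply: ltW.
    have td0 : 0 <= t * (a / p) by apply: mulr_ge0.
    have y40 : 0 <= y / (4 * p) by rewrite divr_ge0 ?mulr_ge0 ?(ltW y0) ?(ltW p0).
    case: (boolP (j \in J1)) => jJ1.
      rewrite mul1r -!addrA lerDl !addr_ge0 // mulr_ge0 //.
    have sA : sl (Y i) j <= t * (a / p).
      apply: le_trans (_ : sl A j <= _).
        rewrite ler_nat subset_leq_card //; apply/subsetP => x.
        by case/setIdP => /(subsetP YA) xA e; apply/setIdP.
      by move: jJ1; rewrite !inE /= -leNgt.
    rewrite mul0r add0r; case: (boolP (j \in J3)) => jJ3.
      rewrite mul1r -addrA; apply: ler_wpDr => //.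
      by rewrite addr_ge0 // mulr_ge0.
    rewrite mul0r add0r; case: (boolP (j \in G)) => jG.
      by rewrite mul1r; apply: ler_wpDl.
    rewrite mul0r addr0 leNgt; apply: contra jG => h.
    rewrite !inE /= /good; apply/and3P; split.
    - by move: jJ1; rewrite !inE /= -leNgt mulrA ler_pdivlMr // mulrC.
    - by rewrite -yE; move: h; rewrite ltr_pdivrMr ?mulr_gt0 // mulrC => /ltW.
    - by move: jJ3; rewrite !inE /= -leNgt.
  have cardE (X : {set J}) : \sum_j (j \in X)%:R = #|X|%:R :> R.
    rewrite -sum1_card natr_sum [RHS]big_mkcond.
    by apply: eq_bigr => j _; case: (j \in X).
  have : y <= y / 4 + #|J3|%:R * (t * (a / p)) + y / 4 + #|G|%:R * (t * (a / p)).
    rewrite {1}yE -sl_sum (le_trans (ler_sum _ (fun j _ => pw j))) //.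
    rewrite !big_split /= -BE (_ : \sum_(j : J) y / (4 * p) = y / 4).
      by rewrite -!mulr_suml !cardE !lerD2r.
    rewrite sumr_const -[LHS]mulr_natr (_ : #|_|%:R = p); last by rewrite pE.
    by field; rewrite lt0r_neq0.
  have hJ3' : #|J3|%:R * (t * (a / p)) <= y / 4.
    have -> : #|J3|%:R * (t * (a / p)) = (#|J3|%:R * t * a) / p.
      by field; rewrite lt0r_neq0.
    rewrite ler_pdivrMr //.
    apply: le_trans (_ : #|J3|%:R * t * (Q * y) <= _).
      by rewrite ler_wpM2l // mulr_ge0 // ?ler0n; lra.
    have : 0 <= y * (p - 4 * Q * t * #|J3|%:R).
      by apply: mulr_ge0; lra.
    lra.
  move=> hy; have {hy} : y / 4 <= #|G|%:R * (t * (a / p)) by lra.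
  rewrite [X in _ <= X](_ : _ = #|G|%:R * t * a / p); last first.
    by field; rewrite lt0r_neq0.
  rewrite ler_pdivlMr // => hy.
  have Qt : 0 < 4 * Q * t by rewrite !mulr_gt0 //; lra.
  rewrite ler_pdivrMr // -(ler_pM2r a0).
  have : a * p <= Q * y * p by rewrite ler_wpM2r // ltW.
  have : 0 <= Q * (#|G|%:R * t * a - y / 4 * p) by apply: mulr_ge0; lra.
  lra.
have [|j _ hj] := H; first by rewrite -card_gt0 cardsT -(ltr0n R) -pE.
set E' := [set i in E | _] in hj.
exists j, E' => [|Aj]; first by apply/subsetP => i; case/setIdP.
have Q'E : Q' = 4 * Q ^+ 2 * t by rewrite /Q' tE; ring.
have Qt0 : 0 < 4 * Q * t by rewrite !mulr_gt0 //; lra.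
have tQ' : 4 * Q * t <= Q'.
  by rewrite Q'E expr2 mulrA ler_pM2r // ler_peMr //; lra.
have hE' : #|E|%:R <= Q' * #|E'|%:R.
  apply: le_trans (_ : 4 * Q * t * #|E'|%:R <= _); last by rewrite ler_wpM2r.
  move: hj; rewrite cardsT -pE mulrAC ler_pdivrMr //.
  by rewrite -[p * _ * (4 * Q * t)]mulrA ler_pM2l // [leRHS]mulrC.
have slI i : #|Y i :&: Aj|%:R = sl (Y i) j \/ ~~ (Y i \subset A).
  case: (boolP (Y i \subset A)) => sYA; [left|by right].
  congr _%:R; apply: eq_card => x; rewrite !inE.
  by case: (boolP (x \in Y i)) => // /(subsetP sYA) ->.
have hi i : i \in E' -> [/\ p * #|Aj|%:R <= t * a, 0 < #|Y i|%:R :> R,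
    a <= Q * #|Y i|%:R, #|Y i|%:R <= 4 * p * #|Y i :&: Aj|%:R
    & r i j <= Q' * cost].
  case/setIdP => iE /and3P[g1 g2 g3]; have [sYA] := hE i iE.
  rewrite -aE => h1 h2 h3 h4.
  have [->|] := slI i; last by rewrite sYA.
  by split=> //; [rewrite -(pmulr_rgt0 _ Qp); apply: lt_le_trans h1|rewrite Q'E; lra].
have E'0 : E' != set0.
  apply: contraTneq hE' => ->; rewrite cards0 mulr0 -ltNge ltr0n card_gt0.
  exact: E0.
have sI i : #|Y i :&: Aj|%:R <= #|Aj|%:R :> R.
  by rewrite ler_nat subset_leq_card // subsetIr.
have QQ : 4 * Q <= 4 * Q * t.
  by rewrite ler_peMr ?mulr_ge0 // (le_trans _ t0) // ler1n.
split=> //.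
- have [i /hi[h _ _ _ _]] := set0Pn _ E'0; apply: (le_trans h).
  rewrite ler_pM2r //; have : 0 <= t * (Q - 1) by apply: mulr_ge0; lra.
  by lra.
- have [i /hi[_ y0 h2 h3 _]] := set0Pn _ E'0; apply: (le_trans h2).
  have pA : 0 <= p * #|Aj|%:R by rewrite mulr_ge0 // ltW.
  apply: le_trans (_ : Q * (4 * (p * #|Aj|%:R)) <= _).
    rewrite ler_wpM2l //.
    by apply: (le_trans h3); rewrite -mulrA !ler_wpM2l // ltW.
  by rewrite mulrA ler_wpM2r //; lra.
- move=> i /hi[h1 y0 h2 h3 h4]; split=> //.
  rewrite -(ler_pM2l p0); apply: (le_trans h1).
  apply: le_trans (_ : t * (Q * (4 * p * #|Y i :&: Aj|%:R)) <= _).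
    rewrite ler_wpM2l //.
    by apply: (le_trans h2); rewrite ler_wpM2l //.
  have pY : 0 <= p * #|Y i :&: Aj|%:R by rewrite mulr_ge0 // ltW.
  have : 0 <= (Q' - 4 * Q * t) * (p * #|Y i :&: Aj|%:R).
    by apply: mulr_ge0 => //; lra.
  lra.
Qed.
End Slicing.

Section Selection.
Variable R : realFieldType.

(** Markov's inequality for the number of bad indices, for the number of pairs of
   indices that [s] identifies, and for a further quantity [X] that has to stay
   near its mean.  The last conclusion says that about [min P #|E|] indices are
   separated. *)
Lemma select_separating (P : R) (Q T I : finType) (S : {set Q}) (X : Q -> R)
    (m : R) (E : {set I}) (h : Q -> I -> T) (bad : Q -> I -> bool) :
  8 <= P -> S != set0 ->
  (forall s, s \in S -> 0 <= X s) -> \sum_(s in S) X s <= #|S|%:R * m ->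
  (forall i, i \in E -> P * #|[set s in S | bad s i]|%:R <= #|S|%:R) ->
  (forall i j, i \in E -> j \in E -> i != j ->
     P * #|[set s in S | h s i == h s j]|%:R <= #|S|%:R) ->
  exists2 s, s \in S & X s <= 4 * m /\
    exists2 E' : {set I}, E' \subset E &
      [/\ forall i, i \in E' -> ~~ bad s i, {in E' &, injective (h s)}
        & P * #|E|%:R <= 16 * (P + #|E|%:R) * #|E'|%:R].
Proof.
move=> P8 S0 X0 hX hbad hsep.
have P0 : 0 < P by lra.
have s0 : 0 < #|S|%:R :> R by rewrite ltr0n card_gt0.
have [e eE] : exists e : R, e = #|E|%:R by exists #|E|%:R.
have e0 : 0 <= e by rewrite eE.
have h2 : \sum_(s in S) collisions R (h s) E <= #|S|%:R * (e + e ^+ 2 / P).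
  rewrite mulrDr mulrA [_ * e ^+ 2]mulrC -mulrA [_ * (_ / P)]mulrC.
  rewrite {1}eE -(collisions_id R E) eE -(collisions_const R E).
  apply: sum_collisions => i j iE jE; rewrite eqxx mulr1 /=.
  have [->|ij] := eqVneq i j.
    rewrite mulr1; apply: ler_wpDr; first by rewrite divr_ge0 // ltW.
    by rewrite ler_nat subset_leq_card //; apply/subsetP => s; case/setIdP.
  by rewrite mulr0 add0r ler_pdivlMr // mulrC hsep.
have h3 : \sum_(s in S) #|[set i in E | bad s i]|%:R <= #|S|%:R * (e / P).
  have -> : \sum_(s in S) #|[set i in E | bad s i]|%:R =
      \sum_(i in E) #|[set s in S | bad s i]|%:R :> R.
    under eq_bigr => s _ do rewrite -sum1dep_card natr_sum.
    under [RHS]eq_bigr => i _ do rewrite -sum1dep_card natr_sum.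
    rewrite (exchange_big_dep (mem E)) /=; last by move=> s i _ /andP[].
    by apply: eq_bigr => i iE; apply: eq_bigl => s; rewrite iE.
  have -> : #|S|%:R * (e / P) = \sum_(i in E) #|S|%:R / P.
    by rewrite sumr_const -[RHS]mulr_natr -eE; field; rewrite lt0r_neq0.
  by apply: ler_sum => i /hbad; rewrite ler_pdivlMr // mulrC.
have m1 := markov X0 (ltr0Sn R 3) hX.
have m2 := markov (fun s _ => collisions_ge0 R (h s) E) (ltr0Sn R 3) h2.
have m3 := markov (fun s _ => ler0n R _) (ltr0Sn R 3) h3.
have [s sS /and3P[g1 g2 g3]] : exists2 s, s \in S &
    [&& X s <= 4 * m, collisions R (h s) E <= 4 * (e + e ^+ 2 / P)
      & #|[set i in E | bad s i]|%:R <= 4 * (e / P)].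
  apply/exists_inP; apply: contraT; rewrite negb_exists_in => /forall_inP hN.
  set B1 := [set s in S | _] in m1; set B2 := [set s in S | _] in m2.
  set B3 := [set s in S | _] in m3.
  have : (#|S| <= #|B1| + #|B2| + #|B3|)%N.
    apply: leq_trans (leq_add (leq_card_setU B1 B2) (leqnn _)).
    apply: leq_trans (leq_card_setU _ _); apply/subset_leq_card/subsetP => s sS.
    by have := hN s sS; rewrite !inE sS !negb_and -!ltNge orbA.
  by rewrite -(ler_nat R) !natrD; lra.
exists s => //; split=> //.
pose E0 := [set i in E | ~~ bad s i].
have sE0 : E0 \subset E by apply/subsetP => i; case/setIdP.
have [E' [sE' inj cE']] := transversal_imset (h s) E0.
exists E'; first exact: subset_trans sE' sE0.
split=> // [i /(subsetP sE') /setIdP[]//|].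
have he0 : e / 2 <= #|E0|%:R.
  have : (#|E| <= #|E0| + #|[set i in E | bad s i]|)%N.
    apply: leq_trans (leq_card_setU _ _); apply/subset_leq_card/subsetP => i iE.
    by rewrite !inE iE orNb.
  rewrite -(ler_nat R) natrD -eE => h4.
  have : e / P <= e / 8 by rewrite ler_wpM2l // lef_pV2 ?posrE //; lra.
  lra.
have := cauchy_schwarz_fibers R (h s) E0; rewrite -cE' => hc.
have [x xE] : exists x : R, x = #|E'|%:R by exists #|E'|%:R.
have x0 : 0 <= x by rewrite xE.
rewrite -?eE -?xE in hc *.
have hE2 : (e / 2) ^+ 2 <= x * (4 * (e + e ^+ 2 / P)).
  apply: le_trans (_ : #|E0|%:R ^+ 2 <= _).
    by rewrite ler_pXn2r ?nnegrE ?divr_ge0.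
  apply: (le_trans hc); rewrite ler_wpM2l //.
  by apply: le_trans g2; apply: collisionsS.
have [->|eN] := eqVneq e 0.
  by rewrite mulr0 addr0 !mulr_ge0 // ltW.
have ep : 0 < e by rewrite lt_def eN.
rewrite -(ler_pM2l ep).
have -> : e * (P * e) = 4 * P * ((e / 2) ^+ 2) by field.
have -> : e * (16 * (P + e) * x) = 4 * P * (x * (4 * (e + e ^+ 2 / P))).
  by field; rewrite lt0r_neq0.
by rewrite ler_wpM2l // mulr_ge0 // ltW.
Qed.

End Selection.

(** * Vectors, functionals and quotients over a finite field *)

Lemma dim_rV (F : fieldType) n (V : {vspace 'rV[F]_n}) : (\dim V <= n)%N.
Proof. by rewrite (leq_trans (dimvS (subvf V))) // dimvf dim_matrix mul1r. Qed.

Section LinearAlgebra.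
Variables (F : finFieldType) (n : nat).
Implicit Types (x y z f v : 'rV[F]_n) (U V W : {vspace 'rV[F]_n}).

Lemma mem_coset V x y : (y \in coset V x) = (y - x \in V).
Proof.
apply/imsetP/idP => [[v vV ->]|yxV]; first by rewrite addrAC subrr add0r.
by exists (y - x); rewrite // addrC subrK.
Qed.

Lemma coset_eq V x y : (coset V x == coset V y) = (x - y \in V).
Proof.
apply/eqP/idP => [e|xyV].
  by rewrite -mem_coset -e mem_coset subrr mem0v.
by apply/setP => z; rewrite !mem_coset -(rpredDr _ xyV) addrA subrK.
Qed.

(** The functional attached to [f] is [x |-> x *m f^T]; the same row vectors
   thus serve as points and as functionals. *)
Definition hyperplane f : {vspace 'rV[F]_n} := lker (linfun (mulmxr f^T)).

Lemma mem_hyperplane f x : (x \in hyperplane f) = (x *m f^T == 0).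
Proof. by rewrite memv_ker lfunE. Qed.

Lemma hyperplaneC f x : (x \in hyperplane f) = (f \in hyperplane x).
Proof.
by rewrite !mem_hyperplane -(inj_eq (@trmx_inj _ _ _)) trmx_mul trmxK trmx0.
Qed.

Let basis_mx V : 'M[F]_(\dim V, n) := \matrix_i (vbasis V)`_i.

Definition annihilator V : {vspace 'rV[F]_n} :=
  lker (linfun (mulmxr (basis_mx V)^T)).

Lemma mem_annihilator V f :
  reflect {in V, forall x, x \in hyperplane f} (f \in annihilator V).
Proof.
rewrite memv_ker lfunE /=; apply: (iffP eqP) => [f0 x xV|h].
  rewrite (coord_vbasis xV) rpred_sum // => i _; apply: rpredZ.
  rewrite hyperplaneC mem_hyperplane; apply/eqP.
  have /matrixP/(_ 0 i) := f0; rewrite !mxE => e; apply/matrixP => a b.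
  by rewrite !ord1 !mxE -[RHS]e; apply: eq_bigr => t _; rewrite !mxE.
apply/matrixP => i j; rewrite mxE [RHS]mxE.
have /h : (vbasis V)`_j \in V by apply/vbasis_mem/mem_nth; rewrite size_tuple.
rewrite hyperplaneC mem_hyperplane => /eqP/matrixP/(_ i 0); rewrite !mxE => e.
by rewrite -[RHS]e; apply: eq_bigr => t _; rewrite !mxE.
Qed.

Lemma dim_annihilator V : (n <= \dim V + \dim (annihilator V))%N.
Proof.
pose B : 'Hom('rV[F]_n, 'rV[F]_(\dim V)) := linfun (mulmxr (basis_mx V)^T).
have := limg_ker_dim B fullv.
rewrite (capfv (lker B)) dimvf dim_matrix mul1r => e.
rewrite addnC; apply: leq_trans (_ : \dim (lker B) + \dim (limg B) <= _)%N.
  by rewrite e.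
by rewrite leq_add2l; apply: dim_rV.
Qed.

(** A functional that vanishes on [V] but not at [z] is a coordinate of the
   projection along [V] onto a complement of [V]. *)
Lemma annihilator_separates V z : z \notin V ->
  exists2 f, f \in annihilator V & z \notin hyperplane f.
Proof.
move=> zV; pose P := daddv_pi V^C V.
have dP : (V^C :&: V)%VS = 0%VS by rewrite capvC capv_compl.
have P0 v : v \in V -> P v = 0.
  move=> vV; have := daddv_pi_add dP (_ : v \in V^C + V)%VS.
  have -> : daddv_pi V V^C v = v by apply: daddv_pi_id; rewrite ?capv_compl.
  rewrite addvC addv_complf memvf => /(_ isT) e.
  by apply: (addIr v); rewrite add0r.
have Pz : P z != 0.
  apply: contraNneq zV => Pz; have := daddv_pi_add dP (_ : z \in V^C + V)%VS.
  by rewrite addvC addv_complf memvf Pz add0r => /(_ isT) <-; apply: memv_pi.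
have [j Pzj] : exists j, P z 0 j != 0.
  apply/existsP; apply: contraNT Pz => /existsPn h; apply/eqP/rowP => j.
  by rewrite mxE; apply/eqP; have := h j; rewrite negbK.
pose f : 'rV[F]_n := (col j (lin1_mx P))^T.
have fE x : x *m f^T = (P x 0 j)%:M.
  rewrite trmxK -mul_rV_lin1; apply/matrixP => a b.
  by rewrite !ord1 !mxE eqxx; apply: eq_bigr => t _; rewrite !mxE.
exists f; last first.
  by rewrite mem_hyperplane fE -scalemx1 scaler_eq0 negb_or Pzj oner_eq0.
by apply/mem_annihilator => x xV; rewrite mem_hyperplane fE P0 // mxE raddf0.
Qed.

Definition nonzero U := [set x in U | x != 0].

Lemma card_nonzero U : #|nonzero U| = (#|F| ^ \dim U).-1.
Proof.
have <- : #|[set x in U]| = (#|F| ^ \dim U)%N by rewrite cardsE card_vspace.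
rewrite (cardsD1 0 [set x in U]) inE mem0v add1n /=.
by apply: eq_card => x; rewrite !inE andbC.
Qed.

(** Leaving out the zero vector is what makes the ratio [1 / #|F|] exact:
   [p * (p ^ e - 1) <= p ^ d - 1] for [e < d]. *)
Lemma card_nonzero_proper U W : ~~ (U <= W)%VS ->
  (#|[set x in nonzero U | x \in W]| * #|F| <= #|nonzero U|)%N.
Proof.
move=> UW; rewrite [[set x in _ | _]](_ : _ = nonzero (U :&: W)); last first.
  by apply/setP => x; rewrite !inE memv_cap andbAC.
rewrite !card_nonzero.
have : (\dim (U :&: W) < \dim U)%N.
  rewrite ltn_neqAle dimvS ?capvSl // andbT.
  apply: contra UW => /eqP e; have /eqP <- : (U :&: W == U)%VS.
    by rewrite -(geq_leqif (dimv_leqif_eq (capvSl U W))) e.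
  exact: capvSr.
have F0 := finNzRing_gt1 F.
move: (\dim _) (\dim _) => e d ed; have := leq_pexp2l (ltnW F0) ed.
by rewrite -!subn1 mulnBl mul1n expnSr => h; apply: leq_sub => //; apply: ltnW.
Qed.

End LinearAlgebra.

(** Quotients by a line are realised by matrices, so that all spaces remain
   spaces of row vectors. *)
Lemma quotient_by_line (F : finFieldType) n (v : 'rV[F]_n.+1) : v != 0 ->
  exists M : 'M[F]_(n.+1, n),
    forall x : 'rV_n.+1, (x *m M == 0) = (x \in <[v]>%VS).
Proof.
move=> v0; pose K := cokermx v.
have [r [er [M hM]]] : exists r, r = n /\
    exists M : 'M[F]_(n.+1, r), 
      forall x : 'rV_n.+1, (x *m M == 0) = (x <= v)%MS.
  exists (\rank K); split; first by rewrite mxrank_coker rank_rV v0 subn1.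
 
  exists (col_base K) => x.
  rewrite submxE -/K -(inj_eq (row_free_inj (row_base_free K))) mul0mx.
  by rewrite -mulmxA mulmx_base.
subst r; exists M => x; rewrite hM.
apply/idP/vlineP => [/sub_rVP|[c ->]]; last exact: scalemx_sub.
by case=> c ->; exists c.
Qed.

Section QuotientMap.
Variables (F : finFieldType) (n : nat) (v : 'rV[F]_n.+1) (M : 'M[F]_(n.+1, n)).
Hypothesis kerM : forall x : 'rV_n.+1, (x *m M == 0) = (x \in <[v]>%VS).
Implicit Types (U V : {vspace 'rV[F]_n.+1}) (A : {set 'rV[F]_n.+1}).

Definition pushV V : {vspace 'rV[F]_n} := (linfun (mulmxr M) @: V)%VS.
Definition push A : {set 'rV[F]_n} := [set x *m M | x in A].

Lemma mem_pushV V y : reflect (exists2 x, x \in V & y = x *m M) (y \in pushV V).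
Proof.
apply: (iffP memv_imgP) => -[x xV ->]; exists x => //; by rewrite lfunE.
Qed.

Lemma eq_mulM (x y : 'rV_n.+1) : (x *m M == y *m M) = (x - y \in <[v]>%VS).
Proof. by rewrite -kerM mulmxBl subr_eq0. Qed.

Lemma pushV_le U V : pushV U = pushV V -> (U <= V + <[v]>)%VS.
Proof.
move=> e; apply/subvP => x xU.
have : x *m M \in pushV U by apply/mem_pushV; exists x.
rewrite e => /mem_pushV[y yV /eqP]; rewrite eq_mulM => xy.
by apply/memv_addP; exists y => //; exists (x - y); rewrite // addrC subrK.
Qed.

Lemma dim_pushV V : (\dim (V :&: <[v]>) + \dim (pushV V))%N = \dim V.
Proof.
rewrite -(limg_ker_dim (linfun (mulmxr M)) V); congr (\dim (_ :&: _) + _)%N.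
by apply/vspaceP => x; rewrite memv_ker lfunE /= kerM.
Qed.

Lemma dim_pushV_inj V : v != 0 -> v \notin V -> \dim (pushV V) = \dim V.
Proof.
move=> v0 vV; rewrite -(dim_pushV V) (_ : (V :&: <[v]>)%VS = 0%VS) ?dimv0 //.
apply/eqP; rewrite -subv0; apply/subvP => x; rewrite memv_cap => /andP[].
move=> + /vlineP[c e]; rewrite {}e rpredZeq => /orP[/eqP->|]; last by rewrite (negPf vV).
by rewrite scale0r mem0v.
Qed.

Lemma dim_pushV_mem V : v != 0 -> v \in V -> (\dim (pushV V)).+1 = \dim V.
Proof.
by move=> v0 vV; rewrite -(dim_pushV V) (capv_idPr _) // dim_vline v0.
Qed.

Lemma card_projection_push V A :
  (#|projection (pushV V) (push A)| <= #|projection V A|)%N.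
Proof.
have -> : projection (pushV V) (push A) = [set push c | c in projection V A].
  rewrite /projection -!imset_comp; apply: eq_imset => x /=.
  apply/setP => y; rewrite mem_coset; apply/mem_pushV/imsetP.
    case=> z zV /eqP; rewrite subr_eq => /eqP e.
    exists (x + z); last by rewrite e mulmxDl addrC.
    by rewrite mem_coset addrAC subrr add0r.
  case=> z; rewrite mem_coset => zx ->; exists (z - x) => //.
  by rewrite mulmxBl.
exact: leq_imset_card.
Qed.

(** Projecting along [<[v]>] keeps the size of [A] if few differences of points
   of [A] are multiples of [v]. *)
Lemma cardsq_push (R : realFieldType) A :
  #|A|%:R ^+ 2 <= #|push A|%:R * collisions R (coset <[v]>) A.
Proof.
rewrite (collisions_eq R (g2 := mulmxr M)); first exact: cauchy_schwarz_fibers.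
by move=> x y; rewrite coset_eq /= eq_mulM.
Qed.

(** Slices by translates of a hyperplane that does not contain [v] are mapped
   injectively: the quotient by [v] identifies the hyperplane with the space of
   one dimension less. *)
Lemma push_hyperplane_inj f (A : {set 'rV[F]_n.+1}) : v \notin hyperplane f ->
  {in A &, forall x y, x *m f^T = y *m f^T} -> #|push A| = #|A|.
Proof.
move=> vf fA; apply: card_in_imset => x y xA yA /eqP; rewrite eq_mulM.
case/vlineP => c e; apply/eqP; rewrite -subr_eq0 e.
suff -> : c = 0 by rewrite scale0r.
have : x - y \in hyperplane f.
  by rewrite mem_hyperplane mulmxBl (fA _ _ xA yA) subrr.
by rewrite e rpredZeq (negPf vf) orbF => /eqP.
Qed.

Lemma pushV_hyperplane_inj f U V : v \notin hyperplane f ->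
  (U <= hyperplane f)%VS -> (V <= hyperplane f)%VS ->
  pushV U = pushV V -> U = V.
Proof.
move=> vf; suff main U' V' : (U' <= hyperplane f)%VS ->
    (V' <= hyperplane f)%VS -> pushV U' = pushV V' -> (U' <= V')%VS.
  move=> Uf Vf e; apply: subv_anti; apply/andP; split; first exact: main.
  exact: main.
move=> Uf Vf /pushV_le/subvP sUV; apply/subvP => x xU.
have /memv_addP[y yV [z zv e]] := sUV x xU.
have /vlineP[c ez] := zv.
have : z \in hyperplane f.
  by rewrite -(rpredDl _ (subvP Vf y yV)) -e; apply: (subvP Uf).
rewrite ez rpredZeq (negPf vf) orbF => /eqP c0.
by rewrite e ez c0 scale0r addr0.
Qed.

End QuotientMap.

(** * Shadings *)

Section Shading.
Variables (R : realFieldType) (F : finFieldType) (I : finType).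

(** All sizes are up to the factor [Q].  Since [Y i] depends on the subspace, it
   can be thinned out for each subspace separately. *)
Definition shading n N (Q al sg : R) (A : {set 'rV[F]_n}) (E : {set I})
    (V : I -> {vspace 'rV[F]_n}) (Y : I -> {set 'rV[F]_n}) : Prop :=
  [/\ {in E &, injective V}, al <= Q * #|A|%:R, #|A|%:R <= Q * al
    & forall i, i \in E -> [/\ \dim (V i) = N, Y i \subset A,
        #|A|%:R <= Q * #|Y i|%:R & #|projection (V i) (Y i)|%:R <= Q * sg]].

Lemma shading_weaken n N (Q Q' al sg : R) (A : {set 'rV[F]_n}) E V Y :
  Q <= Q' -> 0 <= al -> 0 <= sg ->
  shading N Q al sg A E V Y -> shading N Q' al sg A E V Y.
Proof.
move=> QQ al0 sg0 [inj h1 h2 h3]; split=> //.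
- by apply: (le_trans h1); rewrite ler_wpM2r.
- by apply: (le_trans h2); rewrite ler_wpM2r.
move=> i /h3[d1 d2 d3 d4]; split=> //.
  by apply: (le_trans d3); rewrite ler_wpM2r.
by apply: (le_trans d4); rewrite ler_wpM2r.
Qed.

(** Cosets of [V i] with more than [tau] points of [Y i]: there are few of
   them, so either [Y i] is concentrated on few cosets, or half of it lies on
   cosets that are light. *)
Lemma concentrated_or_spread n N (Q al sg tau sg1 : R) (A : {set 'rV[F]_n})
    (E : {set I}) V Y :
  1 <= Q -> 0 < tau -> #|A|%:R / tau <= 2 * Q * sg1 -> 0 <= al ->
  shading N Q al sg A E V Y ->
  exists E1 E2 : {set I}, exists Y1 Y2 : I -> {set 'rV[F]_n},
    [/\ E = E1 :|: E2, shading N (2 * Q) al sg1 A E1 V Y1 &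
      forall i, i \in E2 -> [/\ Y2 i \subset Y i, #|A|%:R <= 2 * Q * #|Y2 i|%:R
        & collisions R (coset (V i)) (Y2 i) <= tau * #|Y2 i|%:R]].
Proof.
move=> Q1 t0 hsg al0 [inj h1 h2 h3].
pose Y1 i := [set x in Y i | tau < #|fiber (coset (V i)) (Y i) x|%:R].
pose Y2 i := [set x in Y i | #|fiber (coset (V i)) (Y i) x|%:R <= tau].
have YE i : #|Y i|%:R = #|Y1 i|%:R + #|Y2 i|%:R :> R.
  rewrite -natrD -(cardsID (Y1 i) (Y i)); congr (_ + _)%:R; apply: eq_card => x.
    by rewrite !inE andbA andbb.
  by rewrite !inE; case: (x \in Y i); rewrite ?andbF //= ?andbT -?leNgt.
pose E1 := [set i in E | #|Y i|%:R <= 2 * #|Y1 i|%:R :> R].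
pose E2 := [set i in E | 2 * #|Y1 i|%:R < #|Y i|%:R :> R].
exists E1, E2, Y1, Y2; split.
- apply/setP => i; rewrite !inE -andb_orr.
  by case: leP; rewrite ?andbT.
- split=> [i j /setIdP[iE _] /setIdP[jE _]|||i /setIdP[/h3[d1 d2 d3 d4] hi]].
  + exact: inj.
  + by apply: (le_trans h1); rewrite ler_wpM2r //; lra.
  + by apply: (le_trans h2); rewrite ler_wpM2r //; lra.
  split=> //.
  + by apply: subset_trans d2; apply/subsetP => x; case/setIdP.
  + apply: (le_trans d3); rewrite [2 * Q]mulrC -mulrA ler_wpM2l //; lra.
  apply: le_trans hsg; rewrite ler_pdivlMr // mulrC.
  apply: (le_trans (card_heavy (coset (V i)) (Y i) tau)).
  by rewrite ler_nat subset_leq_card.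
move=> i /setIdP[/h3[d1 d2 d3 d4] hi]; split.
- by apply/subsetP => x; case/setIdP.
- apply: (le_trans d3); rewrite [2 * Q]mulrC -mulrA ler_wpM2l //.
    by lra.
  by move: hi; rewrite YE; lra.
exact: collisions_light.
Qed.

End Shading.

(** * Reductions to one dimension less *)

Section Reductions.
Variables (R : realFieldType) (F : finFieldType) (I : finType).
Local Notation p := (#|F|%:R : R).

Lemma card_field_gt1 : 2 <= p.
Proof. by rewrite (ler_nat R 2); apply: finNzRing_gt1. Qed.

Definition slice n (f : 'rV[F]_n) (X : {set 'rV[F]_n}) (j : 'M[F]_1) :=
  [set x in X | x *m f^T == j].

Lemma hyperplane_proper n (z : 'rV[F]_n) : z != 0 ->
  ~~ (fullv <= hyperplane z)%VS.
Proof.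
move=> z0; have z0' : z \notin (0%VS : {vspace 'rV[F]_n}) by rewrite memv0.
have [f _] := annihilator_separates z0'.
by apply: contra => /subvP h; rewrite hyperplaneC; apply: h; apply: memvf.
Qed.

(** Along a subspace of the hyperplane [f], different slices have disjoint
   projections. *)
Lemma sum_projection_slices n (f : 'rV[F]_n) V X : (V <= hyperplane f)%VS ->
  (\sum_j #|projection V (slice f X j)| <= #|projection V X|)%N.
Proof.
move=> Vf.
under eq_bigr => j _ do rewrite -sum1_card.
rewrite (exchange_big_dep (mem (projection V X))) /=; last first.
  move=> j c _ /imsetP[x /setIdP[xX _] ->]; exact: imset_f.
rewrite -[leqRHS]sum1_card; apply: leq_sum => c /imsetP[x xX ->].
rewrite sum1dep_card; apply: leq_trans (_ : #|[set x *m f^T]| <= 1)%N.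
  2: by rewrite cards1.
apply/subset_leq_card/subsetP => j; rewrite !inE => /imsetP[y /setIdP[yX /eqP <-]] /eqP.
rewrite coset_eq => /(subvP Vf); rewrite mem_hyperplane mulmxBl subr_eq0.
by rewrite eq_sym.
Qed.

(** A family of subspaces of the hyperplane [f] and a shading whose parts are
   evenly distributed over the translates of that hyperplane: one translate
   inherits a shading by a large subfamily.  The bound on the sum of the
   projections of the slices covers two cases: the projection of [Y i] splits
   into those of its slices, or each slice projects to at most [Q * cost]. *)
Lemma slice_shading n (N : nat) (Q C al cost : R) (A : {set 'rV[F]_n.+1})
    (E : {set I}) (U : I -> {vspace 'rV[F]_n.+1})
    (Y : I -> {set 'rV[F]_n.+1}) (f : 'rV[F]_n.+1) :
  f != 0 -> A != set0 -> E != set0 -> 1 <= C -> 1 <= Q -> 0 < cost -> 0 <= al ->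
  al <= Q * #|A|%:R -> #|A|%:R <= Q * al -> {in E &, injective U} ->
  (forall i, i \in E ->
    [/\ [/\ (U i <= hyperplane f)%VS, \dim (U i) = N & Y i \subset A],
        #|A|%:R <= Q * #|Y i|%:R,
        p * collisions R (fun x => x *m f^T) (Y i) <= C * #|A|%:R ^+ 2
      & \sum_j #|projection (U i) (slice f (Y i) j)|%:R <= p * (Q * cost)]) ->
  let Q' := 64 * C * Q ^+ 5 in
  exists (E' : {set I}) (A' : {set 'rV[F]_n}) V' Y',
    #|E|%:R <= Q' * #|E'|%:R /\ shading N Q' (al / p) cost A' E' V' Y'.
Proof.
move=> f0 A0 E0 C1 Q1 cost0 al0 h1 h2 inj hE Q'.
have p2 := card_field_gt1; have p0 : 0 < p by lra.
have Q0 : 0 <= Q by lra.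
have cM : #|{: 'M[F]_1}|%:R = p by rewrite card_mx expn1.
have [i|j [E' sE [c1 c2 c3 c4]]] := @average_slice R _ _ _ (fun x => x *m f^T)
    A E Y (fun i j => #|projection (U i) (slice f (Y i) j)|%:R) C Q cost
    A0 E0 C1 Q1 cost0.
  by move=> /hE[[d1 d2 d3] d4 d5 d6]; rewrite cM; split.
have [v [vf [M kerM]]] : exists v : 'rV[F]_n.+1, v \notin hyperplane f /\
    exists M : 'M[F]_(n.+1, n), forall x : 'rV_n.+1,
      (x *m M == 0) = (x \in <[v]>%VS).
  have /subvPn[v _ vf] := hyperplane_proper f0.
  exists v; split=> //; apply: quotient_by_line.
  by apply: contraNneq vf => ->; apply: mem0v.
rewrite cM in c2 c3; set Aj := [set x in A | _] in c2 c3 c4.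
set q := 64 * C * Q ^+ 4 in c1 c2 c3 c4.
have Q'E : Q' = Q * q by rewrite /Q' /q exprS; ring.
have q0 : 0 <= q by rewrite /q !mulr_ge0 ?exprn_ge0 //; lra.
have qQ : q <= Q' by rewrite Q'E ler_peMl.
have slE i : i \in E' -> Y i :&: Aj = slice f (Y i) j.
  move=> /(subsetP sE)/hE[[_ _ /subsetP YA] _ _ _]; apply/setP => x.
  by rewrite !inE; case: (boolP (x \in Y i)) => // /YA ->.
have inA (X : {set 'rV[F]_n.+1}) : X \subset Aj ->
    {in X &, forall x y : 'rV_n.+1, x *m f^T = y *m f^T}.
  move=> sX x y xX yX; have := subsetP sX x xX; have := subsetP sX y yX.
  by rewrite !inE => /andP[_ /eqP->] /andP[_ /eqP->].
have cA := push_hyperplane_inj kerM vf (inA _ (subxx _)).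
exists E', (push M Aj), (fun i => pushV M (U i)), (fun i => push M (Y i :&: Aj)).
split; first by apply: (le_trans c1); rewrite ler_wpM2r.
split.
- move=> i i' iE iE' e; have iE1 := subsetP sE i iE; have iE2 := subsetP sE i' iE'.
  apply: inj => //; apply: (pushV_hyperplane_inj kerM vf) e.
    by have [[]] := hE i iE1.
  by have [[]] := hE i' iE2.
- rewrite cA ler_pdivrMr //; apply: (le_trans h1).
  have -> : Q' * #|Aj|%:R * p = Q * (q * (p * #|Aj|%:R)) by rewrite Q'E; ring.
  exact: ler_wpM2l.
- rewrite cA mulrA ler_pdivlMr // mulrC; apply: (le_trans c2).
  have -> : Q' * al = q * (Q * al) by rewrite Q'E; ring.
  exact: ler_wpM2l.
move=> i iE; have [[d1 d2 d3] d4 d5 d6] := hE i (subsetP sE i iE).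
have [e1 e2] := c4 i iE.
have cY := push_hyperplane_inj kerM vf (inA _ (subsetIr (Y i) Aj)).
split.
- rewrite (dim_pushV_inj kerM) //.
    by apply: contraNneq vf => ->; apply: mem0v.
  by apply: contra vf; apply: (subvP d1).
- by apply: imsetS; apply: subsetIr.
- by rewrite cA cY (le_trans e1) // ler_wpM2r.
rewrite slE // in cY *.
apply: le_trans (_ : #|projection (U i) (slice f (Y i) j)|%:R <= _).
  by rewrite ler_nat card_projection_push.
by apply: (le_trans e2); rewrite ler_wpM2r // ltW.
Qed.

Lemma nonzero_neq0 n (V : {vspace 'rV[F]_n}) x : x \in nonzero V -> x != 0.
Proof. by case/setIdP. Qed.

Lemma nonzero_gt0 n (V : {vspace 'rV[F]_n}) : (0 < \dim V)%N ->
  nonzero V != set0.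
Proof.
move=> d0; rewrite -card_gt0 card_nonzero -subn1 subn_gt0.
apply: leq_trans (finNzRing_gt1 F) _.
by rewrite -{1}[#|F|]expn1 leq_exp2l ?finNzRing_gt1.
Qed.

Lemma dim_fullrV n : \dim (fullv : {vspace 'rV[F]_n}) = n.
Proof. by rewrite dimvf dim_matrix mul1r. Qed.

(** Resolves the conclusion of [pigeonhole] when each index is related to half of
   the nonzero vectors of a subspace of codimension [N]. *)
Lemma nonzero_ratio N k (x y : R) : (0 < k)%N -> 0 <= y ->
  (#|F| ^ k).-1%:R / 2 * x <= (#|F| ^ (N + k)).-1%:R * y -> x <= 4 * p ^+ N * y.
Proof.
move=> k0 y0 h.
have F1 : (1 < #|F|)%N := finNzRing_gt1 F.
have k1 : (#|F| <= #|F| ^ k)%N by rewrite -{1}(expn1 #|F|) leq_exp2l.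
have N1 : (0 < #|F| ^ N)%N by rewrite expn_gt0 ltnW.
have h0 : 0 < (#|F| ^ k).-1%:R :> R.
  by rewrite ltr0n -subn1 subn_gt0 (leq_trans F1).
have h1 : (#|F| ^ (N + k)).-1%:R <= 2 * p ^+ N * (#|F| ^ k).-1%:R.
  rewrite -natrX -!natrM ler_nat expnD; move: F1 k1 N1.
  by move: (#|F| ^ k)%N (#|F| ^ N)%N => a b; nia.
rewrite -(ler_pM2l h0).
have := le_trans h (ler_wpM2r y0 h1); lra.
Qed.

(** Slicing by a random hyperplane that contains [V i].  It separates two points
   of different cosets of [V i] with probability about [1 - 1 / p], but never
   two points of the same coset.  The slices of [Y i] are therefore even unless
   much of [Y i] lies on cosets of [V i] with more than a [D / p] fraction of the
   points of [A]; there are at most [p / D] such cosets, and the indices in [E1]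
   are those for which they carry half of [Y i]. *)
Lemma step_slice_containing n N (Q D al sg : R) (A : {set 'rV[F]_n.+1})
    (E : {set I}) (V : I -> {vspace 'rV[F]_n.+1})
    (Y : I -> {set 'rV[F]_n.+1}) :
  (N <= n)%N -> 1 <= Q -> 1 <= D -> 0 < al -> 0 < sg ->
  shading N Q al sg A E V Y ->
  exists E1 E2 : {set I}, exists Y1 : I -> {set 'rV[F]_n.+1},
    [/\ E = E1 :|: E2, shading N (2 * Q) al (p / D) A E1 V Y1 &
      E2 != set0 -> let Q' := 4 * (64 * (4 * D) * (2 * Q) ^+ 5) in
      exists (E' : {set I}) (A' : {set 'rV[F]_n})
          (V' : I -> {vspace 'rV[F]_n}) (Y' : I -> {set 'rV[F]_n}),
        #|E2|%:R <= p ^+ N * (Q' * #|E'|%:R)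
        /\ shading N Q' (al / p) (sg / p) A' E' V' Y'].
Proof.
move=> Nn Q1 D1 al0 sg0 sh; have p2 := card_field_gt1.
have p0 : 0 < p by lra.
have Q0 := le_trans ler01 Q1; have D0 := le_trans ler01 D1.
have QQ : Q <= 2 * Q by lra.
have QQ1 : 1 <= 2 * Q by lra.
have DD : 1 <= 4 * D by lra.
have Qsg : 0 <= Q * sg by rewrite mulr_ge0 // ltW.
have [inj h1 h2 h3] := sh.
have a0 : 0 < #|A|%:R :> R.
  by rewrite -(pmulr_rgt0 _ (_ : 0 < Q)); [apply: lt_le_trans h1|lra].
have [a aE] : exists a : R, a = #|A|%:R by exists #|A|%:R.
have A0 : A != set0 by rewrite -card_gt0 -(ltr0n R).
have t0 : 0 < D * #|A|%:R / p by rewrite divr_gt0 // mulr_gt0 //; lra.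
have pD : 0 <= p / D by rewrite divr_ge0 //; lra.
have [||E1 [E2 [Y1 [Y2 [EE sh1 hE2]]]]] :=
    concentrated_or_spread Q1 t0 (_ : _ <= 2 * Q * (p / D)) _ sh.
- have -> : #|A|%:R / (D * #|A|%:R / p) = p / D.
    by field; rewrite !lt0r_neq0 //; lra.
  by apply: ler_peMl => //; lra.
- exact: ltW.
exists E1, E2, Y1; split=> // E20 Q'.
have sE2 : E2 \subset E by rewrite EE subsetUr.
have [p' p'E] : exists p' : R, p' = p by exists p.
pose m := D * a ^+ 2 / p'.
have p'0 : 0 < p' by rewrite p'E.
have m0 : 0 <= m.
  by apply: divr_ge0; [rewrite mulr_ge0 ?sqr_ge0|apply: ltW].
pose good i (f : 'rV[F]_n.+1) := (f \in annihilator (V i)) &&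
  (collisions R (fun x => x *m f^T) (Y2 i) <= 2 * (2 * m)).
have hgood i : i \in E2 -> (#|F| ^ (n.+1 - N)).-1%:R / 2 <=
    #|[set f in nonzero (fullv : {vspace 'rV[F]_n.+1}) | good i f]|%:R :> R.
  move=> iE; have [d1 d2 d3 _] := h3 i (subsetP sE2 i iE).
  have [e1 e2 e3] := hE2 i iE.
  have sYA : #|Y2 i|%:R <= a.
    by rewrite aE ler_nat subset_leq_card // (subset_trans e1 d2).
  pose S := nonzero (annihilator (V i)).
  have hS : \sum_(f in S) collisions R (fun x => x *m f^T) (Y2 i)
      <= #|S|%:R * (2 * m).
    apply: le_trans (_ : #|S|%:R * collisions R (coset (V i)) (Y2 i) +
        #|S|%:R / p * collisions R (fun=> tt) (Y2 i) <= _).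
      apply: sum_collisions => x y _ _; rewrite eqxx mulr1 coset_eq.
      case: (boolP (x - y \in V i)) => xy.
        rewrite mulr1; apply: ler_wpDr; first by rewrite divr_ge0 // ltW.
        by rewrite ler_nat subset_leq_card //; apply/subsetP => s; case/setIdP.
      rewrite mulr0 add0r ler_pdivlMr // -natrM ler_nat.
      have [f fV xyf] := annihilator_separates xy.
      apply: leq_trans (card_nonzero_proper (_ :
        ~~ (annihilator (V i) <= hyperplane (x - y)))%VS); last first.
        by apply: contra xyf => /subvP h; rewrite hyperplaneC h.
      rewrite leq_mul2r; apply/orP; right; apply/subset_leq_card/subsetP => g.
      case/setIdP => gS /eqP e; apply/setIdP; split=> //.
      by rewrite hyperplaneC mem_hyperplane mulmxBl e subrr.
    rewrite collisions_const -mulrA -mulrDr ler_wpM2l //.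
    have k1 : collisions R (coset (V i)) (Y2 i) <= m.
      apply: (le_trans e3); have -> : m = D * #|A|%:R / p * a.
        by rewrite /m -aE p'E expr2; ring.
      by rewrite ler_wpM2l // ltW.
    have k2 : p^-1 * #|Y2 i|%:R ^+ 2 <= m.
      rewrite mulrC /m p'E ler_pM2r ?invr_gt0 //.
      apply: le_trans (_ : a ^+ 2 <= _).
        by rewrite ler_pXn2r ?nnegrE // aE.
      by rewrite ler_peMl ?sqr_ge0.
    lra.
  pose B := [set f in S |
    2 * (2 * m) < collisions R (fun x => x *m f^T) (Y2 i)].
  have mk : 2 * #|B|%:R <= #|S|%:R :> R.
    by apply: markov hS => // s _; apply: collisions_ge0.
  have cS : (#|S| <= #|B| + #|[set f in nonzero (fullv : {vspace 'rV[F]_n.+1})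
      | good i f]|)%N.
    apply: leq_trans (leq_card_setU _ _); apply/subset_leq_card/subsetP => f fS.
    have /setIdP[fV f0] := fS.
    rewrite in_setU [f \in B]inE fS !inE memvf f0 /good fV /=.
    by case: ltP.
  have cS2 : ((#|F| ^ (n.+1 - N)).-1 <= #|S|)%N.
    rewrite card_nonzero -!subn1 leq_sub2r // leq_exp2l ?finNzRing_gt1 //.
    by rewrite leq_subLR -d1 dim_annihilator.
  move: cS cS2; rewrite -!(ler_nat R) natrD => k1 k2.
  lra.
have [|f fS hf] := pigeonhole _ hgood.
  by apply: nonzero_gt0; rewrite dim_fullrV.
set E3 := [set i in E2 | good i f] in hf.
have f0 := nonzero_neq0 fS.
have hE3 : #|E2|%:R <= 4 * p ^+ N * #|E3|%:R.
  have nN : (0 < n.+1 - N)%N by rewrite subn_gt0.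
  apply: (nonzero_ratio nN) => //; apply: (le_trans hf).
  by rewrite card_nonzero dim_fullrV subnKC // leqW.
have E30 : E3 != set0.
  apply: contraTneq hE3 => ->; rewrite cards0 mulr0 -ltNge ltr0n card_gt0.
  exact: E20.
have sE3 : E3 \subset E.
  by apply: subset_trans sE2; apply/subsetP => i /setIdP[].
have [|||||||i iE|E' [A' [V' [Y' [k1 k2]]]]] := @slice_shading n N
    (2 * Q) (4 * D) al (sg / p) A E3 V Y2 f f0 A0 E30.
- exact: DD.
- exact: QQ1.
- by rewrite divr_gt0.
- exact: ltW.
- by apply: (le_trans h1); rewrite ler_wpM2r.
- by apply: (le_trans h2); rewrite ler_wpM2r // ltW.
- by move=> i j /(subsetP sE3) iE /(subsetP sE3) jE; apply: inj.
- case/setIdP: iE => iE /andP[fV hc].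
  have [d1 d2 d3 d4] := h3 i (subsetP sE2 i iE).
  have [e1 e2 e3] := hE2 i iE.
  have Vf : (V i <= hyperplane f)%VS.
    by apply/subvP; apply/mem_annihilator.
  split=> //.
  + by split=> //; apply: subset_trans d2.
  + apply: le_trans (_ : p * (2 * (2 * m)) <= _); first by rewrite ler_wpM2l // ltW.
    have -> : p * (2 * (2 * m)) = 4 * D * a ^+ 2; last by rewrite aE.
    by rewrite /m p'E; field; rewrite lt0r_neq0.
  rewrite -natr_sum; apply: le_trans (_ : #|projection (V i) (Y i)|%:R <= _).
    rewrite ler_nat; apply: leq_trans (sum_projection_slices _ Vf) _.
    by apply/subset_leq_card/imsetS.
  apply: (le_trans d4).
  have -> : p * (2 * Q * (sg / p)) = 2 * (Q * sg) by field; rewrite lt0r_neq0.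
  by rewrite ler_peMl // ler1n.
exists E', A', V', Y'; split.
  apply: (le_trans hE3).
  have -> : p ^+ N * (Q' * #|E'|%:R) =
      4 * p ^+ N * (64 * (4 * D) * (2 * Q) ^+ 5 * #|E'|%:R) by rewrite /Q'; ring.
  by rewrite ler_wpM2l // mulr_ge0 // exprn_ge0 // ltW.
apply: shading_weaken k2; rewrite ?divr_ge0 ?(ltW al0) ?(ltW sg0) ?(ltW p0) //.
by rewrite ler_peMl ?ler1n // !mulr_ge0 ?exprn_ge0 ?mulr_ge0.
Qed.

Lemma card_natrX n : (#|F| ^ n).-1%:R = p ^+ n - 1 :> R.
Proof.
by rewrite -subn1 natrB ?natrX // expn_gt0 ltnW ?finNzRing_gt1.
Qed.

Lemma card_same_line n (S : {set 'rV[F]_n}) (x y : 'rV[F]_n) : x != y ->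
  {in S, forall v, v != 0} ->
  (#|[set v in S | coset <[v]> x == coset <[v]> y]| <= #|F|.-1)%N.
Proof.
move=> xy S0; rewrite -[X in (_ <= X)%N](_ : #|nonzero <[x - y]>%VS| = _).
  apply/subset_leq_card/subsetP => v /setIdP[vS].
  rewrite coset_eq => /vlineP[c e]; rewrite inE S0 // andbT.
  have c0 : c != 0.
    by apply: contraNneq xy => c0; rewrite -subr_eq0 e c0 scale0r.
  by apply/vlineP; exists c^-1; rewrite e scalerA mulVf // scale1r.
by rewrite card_nonzero dim_vline subr_eq0 xy expn1.
Qed.

(** Projecting along a random line contained in [V i].  Only points of the same
   coset of [V i] can be identified, each such pair with probability about
   [p ^- N].  So [Y i] keeps its size unless most of it lies on cosets with more
   than [p ^+ N * D] points, which are few; this happens for the indices in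
   [E1]. *)
Lemma step_project_inside n N (Q D al sg : R) (A : {set 'rV[F]_n.+1})
    (E : {set I}) (V : I -> {vspace 'rV[F]_n.+1})
    (Y : I -> {set 'rV[F]_n.+1}) :
  (N <= n)%N -> 1 <= Q -> 1 <= D -> 0 < al -> 0 < sg ->
  shading N.+1 Q al sg A E V Y ->
  exists E1 E2 : {set I}, exists Y1 : I -> {set 'rV[F]_n.+1},
    [/\ E = E1 :|: E2,
      shading N.+1 (2 * Q) al (al / (p ^+ N * D)) A E1 V Y1 &
      E2 != set0 -> let Q' := 8 * D * Q ^+ 2 in
      exists (E' : {set I}) (A' : {set 'rV[F]_n})
          (V' : I -> {vspace 'rV[F]_n}) (Y' : I -> {set 'rV[F]_n}),
        #|E2|%:R <= 4 * p ^+ (n - N) * #|E'|%:R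
        /\ shading N Q' al sg A' E' V' Y'].
Proof.
move=> Nn Q1 D1 al0 sg0 sh; have p2 := card_field_gt1.
have p0 : 0 < p by lra.
have Q0 : 0 < Q by lra.
have D0 : 0 < D by lra.
have [inj h1 h2 h3] := sh.
have [tau tauE] : exists tau : R, tau = p ^+ N * D by exists (p ^+ N * D).
have tau0 : 0 < tau by rewrite tauE mulr_gt0 ?exprn_gt0.
rewrite -tauE.
have [||E1 [E2 [Y1 [Y2 [EE sh1 hE2]]]]] :=
    concentrated_or_spread Q1 tau0 (_ : _ <= 2 * Q * (al / tau)) _ sh.
- rewrite mulrA ler_pM2r ?invr_gt0 //; apply: (le_trans h2).
  by rewrite ler_pM2r //; lra.
- exact: ltW.
exists E1, E2, Y1; split=> // E20 Q'.
have sE2 : E2 \subset E by rewrite EE subsetUr.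
pose good i (v : 'rV[F]_n.+1) := (v \in V i) &&
  (collisions R (coset <[v]>) (Y2 i) <= 2 * (2 * D * #|Y2 i|%:R)).
have hgood i : i \in E2 -> (#|F| ^ N.+1).-1%:R / 2 <=
    #|[set v in nonzero (fullv : {vspace 'rV[F]_n.+1}) | good i v]|%:R :> R.
  move=> iE; have [d1 d2 d3 _] := h3 i (subsetP sE2 i iE).
  have [e1 e2 e3] := hE2 i iE.
  have [y yE] : exists y : R, y = #|Y2 i|%:R by exists #|Y2 i|%:R.
  have y0 : 0 <= y by rewrite yE.
  pose S := nonzero (V i).
  have cS : #|S|%:R = p ^+ N.+1 - 1 by rewrite card_nonzero d1 card_natrX.
  have hS : \sum_(v in S) collisions R (coset <[v]>) (Y2 i)
      <= #|S|%:R * (2 * D * y).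
    apply: le_trans (_ : #|S|%:R * collisions R id (Y2 i) +
        (p - 1) * collisions R (coset (V i)) (Y2 i) <= _).
      apply: sum_collisions => x x' _ _ /=; rewrite coset_eq.
      have [->|xx] := eqVneq x x'.
        rewrite mulr1; apply: ler_wpDr; first by rewrite mulr_ge0 //; lra.
        by rewrite ler_nat subset_leq_card //; apply/subsetP => s; case/setIdP.
      rewrite mulr0 add0r; case: (boolP (x - x' \in V i)) => xV.
        rewrite mulr1; have -> : p - 1 = #|F|.-1%:R.
          by rewrite -(expn1 #|F|) card_natrX expr1.
        by rewrite ler_nat card_same_line // => v; apply: nonzero_neq0.
      rewrite mulr0 [X in #|pred_of_set X|](_ : _ = set0) ?cards0 //.
      apply/setP => v; rewrite [RHS]inE; apply/negP => /setIdP[/setIdP[vV _]].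
      rewrite coset_eq => /vlineP[c e]; case/negP: xV; rewrite e.
      by rewrite rpredZ.
    rewrite collisions_id -yE cS.
    have -> : (p ^+ N.+1 - 1) * (2 * D * y) = (p ^+ N.+1 - 1) * y * D +
      (p ^+ N.+1 - 1) * D * y by ring.
    have pN : 1 <= p ^+ N by rewrite exprn_ege1 //; lra.
    have pN1 : 0 <= p ^+ N.+1 - 1.
      by rewrite subr_ge0 exprn_ege1 //; lra.
    apply: lerD; first by rewrite ler_peMr // mulr_ge0.
    apply: le_trans (_ : (p - 1) * (tau * y) <= _).
      by rewrite ler_wpM2l ?subr_ge0 ?yE //; lra.
    rewrite tauE !mulrA ler_wpM2r // ler_wpM2r ?(ltW D0) // exprS; lra.
  pose B := [set v in S |
    2 * (2 * D * y) < collisions R (coset <[v]>) (Y2 i)].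
  have mk : 2 * #|B|%:R <= #|S|%:R :> R.
    by apply: markov hS => // s _; apply: collisions_ge0.
  have cSB : (#|S| <= #|B| + #|[set v in nonzero (fullv : {vspace 'rV[F]_n.+1})
      | good i v]|)%N.
    apply: leq_trans (leq_card_setU _ _); apply/subset_leq_card/subsetP => v vS.
    have /setIdP[vV v0] := vS.
    rewrite in_setU [v \in B]inE vS !inE memvf v0 /good vV /= -yE.
    by case: ltP.
  by move: cSB; rewrite -(ler_nat R) natrD -d1 -card_nonzero; lra.
have [|v vS hv] := pigeonhole _ hgood.
  by apply: nonzero_gt0; rewrite dim_fullrV.
set E3 := [set i in E2 | good i v] in hv.
have v0 := nonzero_neq0 vS.
have hE3 : #|E2|%:R <= 4 * p ^+ (n - N) * #|E3|%:R.
  apply: (nonzero_ratio (ltn0Sn N)) => //; apply: (le_trans hv).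
  by rewrite card_nonzero dim_fullrV addnS subnK.
have E30 : E3 != set0.
  apply: contraTneq hE3 => ->; rewrite cards0 mulr0 -ltNge ltr0n card_gt0.
  exact: E20.
have sE3 i : i \in E3 -> [/\ i \in E, i \in E2, v \in V i &
    collisions R (coset <[v]>) (Y2 i) <= 2 * (2 * D * #|Y2 i|%:R)].
  by case/setIdP => iE /andP[? ?]; split=> //; apply: (subsetP sE2).
have [M kerM] := quotient_by_line v0.
exists E3, (push M A), (fun i => pushV M (V i)), (fun i => push M (Y2 i)).
split=> //.
have cA : #|push M A|%:R <= #|A|%:R :> R by rewrite ler_nat leq_imset_card.
have hY i : i \in E3 -> #|A|%:R <= 8 * D * Q * #|push M (Y2 i)|%:R.
  case/sE3 => iE iE2 _ hc; have [_ e2 _] := hE2 i iE2.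
  have [y yE] : exists y : R, y = #|Y2 i|%:R by exists #|Y2 i|%:R.
  have := cardsq_push kerM R (Y2 i); rewrite -yE in e2 hc *.
  move: (#|push M (Y2 i)|%:R) (ler0n R #|push M (Y2 i)|) => z z0 hz.
  have y0 : 0 <= y by rewrite yE.
  have hz2 : y ^+ 2 <= z * (4 * D * y).
    apply: (le_trans hz); rewrite ler_wpM2l //; lra.
  apply: (le_trans e2).
  have -> : 8 * D * Q * z = 2 * Q * (4 * D * z) by ring.
  rewrite ler_pM2l ?mulr_gt0 //.
  have [->|yN] := eqVneq y 0; first by rewrite !mulr_ge0 // ltW.
  have yp : 0 < y by rewrite lt_def yN.
  rewrite -(ler_pM2r yp) -expr2 (le_trans hz2) //.
  by rewrite le_eqVlt; apply/orP; left; apply/eqP; ring.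
have Q'E : Q' = 8 * D * Q * Q by rewrite /Q' expr2 mulrA.
have Q'Q : 8 * D * Q <= Q'.
  by rewrite Q'E ler_peMr // !mulr_ge0 // ltW.
have Q'1 : Q <= Q'.
  by rewrite Q'E ler_peMl ?(ltW Q0) // !mulr_ege1 ?ler1n.
split.
- move=> i j iE jE e; have [iE0 _ vi _] := sE3 i iE.
  have [jE0 _ vj _] := sE3 j jE.
  apply: inj => //; apply: subv_anti; apply/andP; split.
    by apply: subv_trans (pushV_le kerM e) _; rewrite subv_add subvv.
  by apply: subv_trans (pushV_le kerM (esym e)) _; rewrite subv_add subvv.
- have [i iE] := set0Pn _ E30; have := hY i iE => k1.
  apply: (le_trans h1); rewrite Q'E mulrAC [leRHS]mulrC ler_wpM2l ?(ltW Q0) //.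
  apply: (le_trans k1); rewrite ler_wpM2l ?ler_nat ?mulr_ge0 ?(ltW D0) ?(ltW Q0) //.
  apply/subset_leq_card/imsetS; have [iE0 iE2 _ _] := sE3 i iE.
  have [e1 _ _] := hE2 i iE2; have [_ d2 _ _] := h3 i iE0.
  exact: subset_trans d2.
- apply: (le_trans cA); apply: (le_trans h2); rewrite ler_wpM2r // ltW //.
move=> i iE; have [iE0 iE2 vi _] := sE3 i iE.
have [e1 _ _] := hE2 i iE2; have [d1 d2 _ d4] := h3 i iE0.
split.
- by have := dim_pushV_mem kerM v0 vi; rewrite d1 => -[].
- by apply: imsetS; apply: subset_trans d2.
- apply: (le_trans cA); apply: (le_trans (hY i iE)).
  by rewrite ler_wpM2r.
apply: le_trans (_ : Q * sg <= _); last by rewrite ler_wpM2r // ltW.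
apply: le_trans d4; rewrite ler_nat.
apply: leq_trans (card_projection_push M (V i) (Y2 i)) _.
by apply/subset_leq_card/imsetS.
Qed.

Lemma card_proper_ratio n (X : {set 'rV[F]_n}) W :
  ~~ (fullv <= W)%VS -> {in X, forall x, x \in W} ->
  p * #|[set x in nonzero fullv | x \in X]|%:R
    <= #|nonzero (fullv : {vspace 'rV[F]_n})|%:R.
Proof.
move=> hW hX; rewrite -natrM ler_nat mulnC.
apply: leq_trans (card_nonzero_proper hW); rewrite leq_mul2r.
apply/orP; right; apply/subset_leq_card/subsetP => x /setIdP[x0 /hX xW].
by apply/setIdP.
Qed.

Lemma dim_cap_hyperplane n (V : {vspace 'rV[F]_n}) f :
  (\dim V <= (\dim (V :&: hyperplane f)).+1)%N.
Proof.
rewrite -(limg_ker_dim (linfun (mulmxr f^T)) V) -/(hyperplane f).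
have := dim_rV (linfun (mulmxr f^T) @: V : {vspace 'rV[F]_1}).
by move: (\dim _) (\dim _) => d e; rewrite -(leq_add2l d) addn1.
Qed.

(** Slicing by a random hyperplane.  If two subspaces have the same trace on it,
   then it contains their intersection, which is nonzero as [N] is positive;
   hence distinct subspaces rarely have the same trace. *)
Lemma step_slice_generic n N (Q al sg : R) (A : {set 'rV[F]_n.+1})
    (E : {set I}) (V : I -> {vspace 'rV[F]_n.+1})
    (Y : I -> {set 'rV[F]_n.+1}) :
  8 <= p -> (0 < N)%N -> 1 <= Q -> p <= al -> 0 < sg -> E != set0 ->
  shading N.+1 Q al sg A E V Y ->
  let Q' := 64 * (8 * Q) * Q ^+ 5 in
  exists (E' : {set I}) (A' : {set 'rV[F]_n})
      (V' : I -> {vspace 'rV[F]_n}) (Y' : I -> {set 'rV[F]_n}),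
    p * #|E|%:R <= 16 * (p + #|E|%:R) * (Q' * #|E'|%:R)
    /\ shading N Q' (al / p) sg A' E' V' Y'.
Proof.
move=> p8 N0 Q1 pal sg0 E0 [inj h1 h2 h3] Q'.
have p0 : 0 < p by lra.
have Q0 : 0 < Q by lra.
have al0 : 0 < al by lra.
have [a aE] : exists a : R, a = #|A|%:R by exists #|A|%:R.
have a0 : 0 < a.
  by rewrite -(pmulr_rgt0 _ Q0) aE; apply: lt_le_trans h1.
have A0 : A != set0 by rewrite -card_gt0 -(ltr0n R) -aE.
pose S := nonzero (fullv : {vspace 'rV[F]_n.+1}).
have S0 : S != set0 by apply: nonzero_gt0; rewrite dim_fullrV.
have hX : \sum_(f in S) collisions R (fun x => x *m f^T) A
    <= #|S|%:R * (a + a ^+ 2 / p).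
  apply: le_trans (_ : #|S|%:R * collisions R id A +
      #|S|%:R / p * collisions R (fun=> tt) A <= _); last first.
    rewrite collisions_id collisions_const -aE le_eqVlt.
    by apply/orP; left; apply/eqP; ring.
  apply: sum_collisions => x y _ _; rewrite eqxx mulr1 /=.
  have [->|xy] := eqVneq x y.
    rewrite mulr1; apply: ler_wpDr; first by rewrite divr_ge0 // ltW.
    by rewrite ler_nat subset_leq_card //; apply/subsetP => s; case/setIdP.
  rewrite mulr0 add0r ler_pdivlMr // mulrC.
  rewrite -subr_eq0 in xy.
  rewrite [X in #|pred_of_set X|](_ : _ = [set f in nonzero fullv |
      f \in [set f | f \in hyperplane (x - y)]]).
    apply: card_proper_ratio (hyperplane_proper xy) _ => f.
    by rewrite inE.
  apply/setP => f; rewrite !inE hyperplaneC mem_hyperplane mulmxBl subr_eq0.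
  by [].
have V0 i : i \in E -> exists2 z, z != 0 & z \in V i.
  move=> iE; have [d1 _ _ _] := h3 i iE.
  exists (vpick (V i)); last exact: memv_pick.
  by rewrite vpick0 -dimv_eq0 d1.
have [f fS [hf [E' sE' [hbad hinj hE']]]] : exists2 f, f \in S &
  collisions R (fun x => x *m f^T) A <= 4 * (a + a ^+ 2 / p) /\
    exists2 E' : {set I}, E' \subset E &
      [/\ forall i, i \in E' -> ~~ (V i <= hyperplane f)%VS,
        {in E' &, injective (fun i => V i :&: hyperplane f)%VS}
        & p * #|E|%:R <= 16 * (p + #|E|%:R) * #|E'|%:R].
  apply: select_separating => //.
  - by move=> s _; apply: collisions_ge0.
  - move=> i /V0[z z0 zV].
    rewrite [X in #|pred_of_set X|](_ : _ = [set f in nonzero fullv |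
      f \in [set f | (V i <= hyperplane f)%VS]]).
      apply: card_proper_ratio (hyperplane_proper z0) _ => f.
      by rewrite inE hyperplaneC => /subvP; apply.
    by apply/setP => f; rewrite !inE.
  move=> i j iE jE ij.
  have [d1 _ _ _] := h3 i iE; have [d1' _ _ _] := h3 j jE.
  pose W := (V i :&: V j)%VS.
  have dW f : (V i :&: hyperplane f = V j :&: hyperplane f)%VS ->
      (W <= hyperplane f)%VS /\ W != 0%VS.
    move=> e; have sW : (V i :&: hyperplane f <= W)%VS.
      by rewrite subv_cap capvSl e capvSl.
    have dc : (N <= \dim (V i :&: hyperplane f))%N.
      by rewrite -ltnS -d1 dim_cap_hyperplane.
    have dW : (\dim W <= N)%N.
      rewrite -ltnS -d1 ltn_neqAle dimvS ?capvSl // andbT.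
      apply: contra ij => /eqP e1; apply/eqP/inj => //.
      have /eqP e2 : W == V i by rewrite eqEdim capvSl e1 leqnn.
      have s : (V i <= V j)%VS by rewrite -e2 capvSr.
      by apply/eqP; rewrite eqEdim s d1 d1' leqnn.
    have /eqP <- : (V i :&: hyperplane f == W)%VS.
      by rewrite eqEdim sW (leq_trans dW).
    split; first exact: capvSr.
    by rewrite -dimv_eq0 -lt0n (leq_trans N0).
  rewrite [X in #|pred_of_set X|](_ : _ = [set f in nonzero fullv |
    f \in [set f | (V i :&: hyperplane f)%VS == (V j :&: hyperplane f)%VS]]);
    last by apply/setP => f; rewrite !inE.
  have [W0|W0] := eqVneq W 0%VS.
    rewrite [X in #|pred_of_set X|](_ : _ = set0) ?cards0 ?mulr0 //.
    apply/setP => f; rewrite !inE; apply/negP => /andP[_ /eqP /dW[_]].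
    by rewrite W0 eqxx.
  have z0 : vpick W != 0 by rewrite vpick0.
  apply: card_proper_ratio (hyperplane_proper z0) _ => f.
  rewrite inE hyperplaneC => /eqP/dW[/subvP h _]; apply: h; exact: memv_pick.
have f0 := nonzero_neq0 fS.
have E'0 : E' != set0.
  apply: contraTneq hE' => ->; rewrite cards0 mulr0 -ltNge mulr_gt0 // ltr0n card_gt0.
  exact: E0.
have [|||||i iE|E3 [A' [V' [Y' [k1 k2]]]]] := @slice_shading n N
    Q (8 * Q) al sg A E' (fun i => V i :&: hyperplane f)%VS Y f f0 A0 E'0
    _ Q1 sg0 _ _ _ _ _.
- by lra.
- exact: ltW.
- exact: h1.
- exact: h2.
- exact: hinj.
- have [d1 d2 d3 d4] := h3 i (subsetP sE' i iE).
  split=> //.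
  + split=> //; first exact: capvSr.
    apply/eqP; rewrite eqn_leq; apply/andP; split.
      rewrite -ltnS -d1 ltn_neqAle dimvS ?capvSl // andbT.
      apply: contra (hbad i iE) => /eqP e2.
      have /eqP <- : (V i :&: hyperplane f == V i)%VS.
        by rewrite eqEdim capvSl e2 leqnn.
      exact: capvSr.
    by rewrite -ltnS -d1 dim_cap_hyperplane.
  + apply: le_trans (_ : p * (4 * (a + a ^+ 2 / p)) <= _).
      rewrite ler_wpM2l ?(ltW p0) //; apply: le_trans hf.
      exact: collisionsS.
    have -> : p * (4 * (a + a ^+ 2 / p)) = 4 * (p * a + a ^+ 2).
      by field; rewrite lt0r_neq0.
    rewrite -aE; have : p * a <= Q * a ^+ 2.
      by rewrite expr2 mulrA ler_pM2r // (le_trans pal) // aE.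
    have : a ^+ 2 <= Q * a ^+ 2 by rewrite ler_peMl ?sqr_ge0.
    lra.
  have -> : p * (Q * sg) = \sum_(j : 'M[F]_1) Q * sg.
    by rewrite sumr_const -[RHS]mulr_natl cardT -cardE card_mx expn1.
  apply: ler_sum => j _; apply: le_trans d4; rewrite ler_nat.
  set X := slice f (Y i) j.
  apply: leq_trans (_ : #|projection (V i) X| <= _)%N; last first.
    by apply/subset_leq_card/imsetS/subsetP => x /setIdP[].
  have -> : projection (V i :&: hyperplane f) X =
      (fun c : {set 'rV[F]_n.+1} => slice f c j) @: projection (V i) X.
    rewrite /projection -imset_comp; apply: eq_in_imset => x /setIdP[_ /eqP xj].
    apply/setP => y; rewrite /= [RHS]inE !mem_coset memv_cap mem_hyperplane mulmxBl xj.
    by rewrite subr_eq0.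
  exact: leq_imset_card.
exists E3, A', V', Y'; split=> //.
apply: (le_trans hE'); rewrite ler_wpM2l //.
by rewrite mulr_ge0 // addr_ge0 // ltW.
Qed.

(** Projecting along a random line.  If [V i + <[v]> = V j + <[v]>] for distinct
   [V i] and [V j], then [v] lies in [V i + V j], whose dimension is at most
   [N + 1 <= n]; hence distinct subspaces rarely have the same image. *)
Lemma step_project_generic n N (Q al sg : R) (A : {set 'rV[F]_n.+1})
    (E : {set I}) (V : I -> {vspace 'rV[F]_n.+1})
    (Y : I -> {set 'rV[F]_n.+1}) :
  8 <= p -> (N < n)%N -> 1 <= Q -> 0 < al -> al <= p ^+ n -> 0 < sg ->
  E != set0 -> shading N Q al sg A E V Y ->
  let Q' := 8 * Q ^+ 4 in
  exists (E' : {set I}) (A' : {set 'rV[F]_n})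
      (V' : I -> {vspace 'rV[F]_n}) (Y' : I -> {set 'rV[F]_n}),
    p * #|E|%:R <= 16 * (p + #|E|%:R) * #|E'|%:R
    /\ shading N Q' al sg A' E' V' Y'.
Proof.
move=> p8 Nn Q1 al0 alp sg0 E0 [inj h1 h2 h3] Q'.
have p0 : 0 < p by lra.
have Q0 : 0 < Q by lra.
have [a aE] : exists a : R, a = #|A|%:R by exists #|A|%:R.
have a0 : 0 < a.
  by rewrite -(pmulr_rgt0 _ Q0) aE; apply: lt_le_trans h1.
pose S := nonzero (fullv : {vspace 'rV[F]_n.+1}).
have S0 : S != set0 by apply: nonzero_gt0; rewrite dim_fullrV.
have cS : #|S|%:R = p ^+ n.+1 - 1 by rewrite card_nonzero dim_fullrV card_natrX.
have hX : \sum_(v in S) collisions R (coset <[v]>) A <= #|S|%:R * (2 * Q * a).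
  apply: le_trans (_ : #|S|%:R * collisions R id A +
      (p - 1) * collisions R (fun=> tt) A <= _).
    apply: sum_collisions => x y _ _; rewrite eqxx mulr1 /=.
    have [->|xy] := eqVneq x y.
      rewrite mulr1; apply: ler_wpDr; first by rewrite subr_ge0; lra.
      by rewrite ler_nat subset_leq_card //; apply/subsetP => s; case/setIdP.
    rewrite mulr0 add0r; have -> : p - 1 = #|F|.-1%:R.
      by rewrite -(expn1 #|F|) card_natrX expr1.
    by rewrite ler_nat card_same_line // => v; apply: nonzero_neq0.
  rewrite collisions_id collisions_const -aE cS.
  have pn : 1 <= p ^+ n by rewrite exprn_ege1 //; lra.
  have pn1 : 0 <= p ^+ n.+1 - 1 by rewrite subr_ge0 exprn_ege1 //; lra.
  have -> : (p ^+ n.+1 - 1) * (2 * Q * a) = (p ^+ n.+1 - 1) * a * Q +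
      (p ^+ n.+1 - 1) * (Q * a) by ring.
  apply: lerD; first by rewrite ler_peMr // mulr_ge0 // ltW.
  have ha : a <= Q * p ^+ n.
    by rewrite aE; apply: (le_trans h2); rewrite ler_wpM2l // ltW.
  apply: le_trans (_ : (p - 1) * (Q * p ^+ n * a) <= _).
    by rewrite ler_wpM2l ?subr_ge0 1?expr2 ?ler_wpM2r ?(ltW a0) //; lra.
  have -> : (p - 1) * (Q * p ^+ n * a) = (p ^+ n.+1 - p ^+ n) * (Q * a).
    by rewrite exprS; ring.
  by rewrite ler_wpM2r ?mulr_ge0 ?(ltW Q0) ?(ltW a0) // lerD2l lerN2.
have [v vS [hv [E' sE' [hbad hinj hE']]]] : exists2 v, v \in S &
  collisions R (coset <[v]>) A <= 4 * (2 * Q * a) /\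
    exists2 E' : {set I}, E' \subset E &
      [/\ forall i, i \in E' -> ~~ (v \in V i),
        {in E' &, injective (fun i => V i + <[v]>)%VS}
        & p * #|E|%:R <= 16 * (p + #|E|%:R) * #|E'|%:R].
  apply: select_separating => //.
  - by move=> s _; apply: collisions_ge0.
  - move=> i iE; have [d1 _ _ _] := h3 i iE.
    rewrite [X in #|pred_of_set X|](_ : _ = [set v in nonzero fullv |
      v \in [set v | v \in V i]]); last by apply/setP => v; rewrite !inE.
    apply: (card_proper_ratio (W := V i)) => [|v]; last by rewrite inE.
    by apply/negP => /dimvS; rewrite dim_fullrV d1 leqNgt ltnS ltnW.
  move=> i j iE jE ij.
  have [d1 _ _ _] := h3 i iE; have [d1' _ _ _] := h3 j jE.
  have hW v : v != 0 -> (V i + <[v]> = V j + <[v]>)%VS -> 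
      (v \in (V i + V j)%VS) /\ ~~ (fullv <= V i + V j)%VS.
    move=> v0 e; split.
      have /subvPn[y yj yi] : ~~ (V j <= V i)%VS.
        apply: contra ij => s; apply/eqP/inj => //; apply/eqP.
        by rewrite eq_sym eqEdim s d1 d1' leqnn.
      have /memv_addP[x xi [z /vlineP[c ->] yE]] : y \in (V i + <[v]>)%VS.
        by rewrite e; apply: (subvP (addvSl _ _)).
      have c0 : c != 0.
        by apply: contraNneq yi => c0; rewrite yE c0 scale0r addr0.
      have -> : v = c^-1 *: (y - x).
        by rewrite yE addrAC subrr add0r scalerA mulVf // scale1r.
      rewrite memvZ // rpredB //; first exact: (subvP (addvSr _ _)).
      exact: (subvP (addvSl _ _)).
    have s : (V i + V j <= V i + <[v]>)%VS.
      by rewrite subv_add addvSl e addvSl.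
    apply/negP => /dimvS; rewrite dim_fullrV => h.
    have := leq_trans h (leq_trans (dimvS s) (dimv_add_leqif _ _)).
    by rewrite d1 dim_vline v0 addn1 ltnS leqNgt Nn.
  rewrite [X in #|pred_of_set X|](_ : _ = [set v in nonzero fullv |
    v \in [set v : 'rV[F]_n.+1 | (v != 0) &&
      (V i + <[v]> == V j + <[v]>)%VS]]); last first.
    by apply/setP => v; rewrite !inE; case: (v != 0); rewrite ?andbF.
  set X := [set v : 'rV[F]_n.+1 | _ && _].
  have [-> | /set0Pn[w]] := eqVneq X set0.
    rewrite [X in #|pred_of_set X|](_ : _ = set0) ?cards0 ?mulr0 //.
    by apply/setP => v; rewrite !inE andbF.
  rewrite inE => /andP[w0 /eqP ew]; have [_ hp] := hW w w0 ew.
  apply: (card_proper_ratio hp) => v; rewrite inE => /andP[v0 /eqP ev].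
  by have [] := hW v v0 ev.
have v0 := nonzero_neq0 vS.
have [M kerM] := quotient_by_line v0.
have E'0 : E' != set0.
  apply: contraTneq hE' => ->; rewrite cards0 mulr0 -ltNge mulr_gt0 // ltr0n card_gt0.
  exact: E0.
exists E', (push M A), (fun i => pushV M (V i)), (fun i => push M (Y i)).
split=> //.
have cA : #|push M A|%:R <= #|A|%:R :> R by rewrite ler_nat leq_imset_card.
have hY i : i \in E' -> #|A|%:R <= 8 * Q ^+ 3 * #|push M (Y i)|%:R.
  move=> iE; have [_ d2 d3 _] := h3 i (subsetP sE' i iE).
  have [y yE] : exists y : R, y = #|Y i|%:R by exists #|Y i|%:R.
  have := cardsq_push kerM R (Y i); rewrite -yE -?aE in d3 *.
  move: (#|push M (Y i)|%:R) (ler0n R #|push M (Y i)|) => z z0 hz.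
  have hz2 : y ^+ 2 <= z * (8 * Q * a).
    apply: (le_trans hz); rewrite ler_wpM2l //.
    apply: (le_trans (collisionsS _ _ d2)); apply: (le_trans hv).
    by rewrite !mulrA ler_wpM2r ?(ltW a0) // ler_wpM2r ?(ltW Q0) //; lra.
  rewrite -(ler_pM2l a0) -expr2.
  apply: le_trans (_ : (Q * y) ^+ 2 <= _).
    by rewrite ler_pXn2r ?nnegrE ?(ltW a0) // mulr_ge0 ?yE // ltW.
  rewrite exprMn; have -> : a * (8 * Q ^+ 3 * z) = Q ^+ 2 * (z * (8 * Q * a)).
    by ring.
  by rewrite ler_wpM2l // sqr_ge0.
have Q'E : Q' = Q * (8 * Q ^+ 3) by rewrite /Q'; ring.
have Q31 : 1 <= 8 * Q ^+ 3 by rewrite mulr_ege1 ?exprn_ege1 //; lra.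
have Q30 : 0 <= 8 * Q ^+ 3 by lra.
have Q'1 : Q <= Q' by rewrite Q'E ler_peMr // ltW.
have Q'3 : 8 * Q ^+ 3 <= Q' by rewrite Q'E ler_peMl.
split.
- move=> i j iE jE e; apply: hinj => //; apply: subv_anti; apply/andP.
  by split; rewrite subv_add addvSr ?(pushV_le kerM e) ?(pushV_le kerM (esym e)).
- have [i iE] := set0Pn _ E'0; have := hY i iE => k1.
  have [_ d2 _ _] := h3 i (subsetP sE' i iE).
  apply: (le_trans h1); rewrite Q'E -mulrA ler_wpM2l ?(ltW Q0) //.
  apply: (le_trans k1); rewrite ler_wpM2l ?ler_nat //.
  by apply/subset_leq_card/imsetS.
- by apply: (le_trans cA); apply: (le_trans h2); rewrite ler_wpM2r // ltW.
move=> i iE; have [d1 d2 d3 d4] := h3 i (subsetP sE' i iE).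
split.
- by rewrite (dim_pushV_inj kerM) // hbad.
- exact: imsetS.
- apply: (le_trans cA); apply: (le_trans (hY i iE)).
  by rewrite ler_wpM2r.
apply: le_trans (_ : Q * sg <= _); last by rewrite ler_wpM2r // ltW.
apply: le_trans d4; rewrite ler_nat; exact: card_projection_push.
Qed.

End Reductions.

(** * Exponents *)

Section Powers.
Variable R : realType.
Implicit Types (x r s d : R).

Lemma powR_add x r s : 0 < x -> x `^ (r + s) = x `^ r * x `^ s.
Proof. by move=> x0; rewrite powRD // (gt_eqF x0) implybT. Qed.

Lemma powR_mulnX x d n : 0 <= x -> (x `^ d) ^+ n = x `^ (d * n%:R).
Proof. by move=> x0; rewrite powRrM powR_mulrn // powR_ge0. Qed.

Lemma ltr_powR x r s : 1 < x -> r < s -> x `^ r < x `^ s.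
Proof.
move=> x1 rs; have x0 : 0 < x by lra.
rewrite -[s](subrK r) addrC powR_add // -[ltLHS]mulr1 ltr_pM2l ?powR_gt0 //.
have -> : 1 = 1 `^ (s - r) :> R by rewrite powR1.
by apply: gt0_ltr_powR; rewrite ?nnegrE ?subr_gt0 //; lra.
Qed.

Lemma powR_le_inv x r s : 1 < x -> x `^ r <= x `^ s -> r <= s.
Proof. by move=> x1; rewrite !leNgt; apply: contra; apply: ltr_powR. Qed.

(** Positive powers of [p] absorb constants. *)
Lemma powR_large d K : 0 < d ->
  exists p0 : nat, forall p : nat, (p0 <= p)%N -> K <= p%:R `^ d.
Proof.
move=> d0; pose x := (Num.max K 1) `^ d^-1.
have x0 : 0 <= x by apply: powR_ge0.
exists (Num.bound x) => p hp.
have xp : x <= p%:R.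
  by apply: le_trans (ltW (archi_boundP x0)) _; rewrite ler_nat.
have K1 : 0 <= Num.max K 1 by rewrite le_max ler01 orbT.
apply: le_trans (_ : x `^ d <= _).
  by rewrite /x -powRrM mulVf ?lt0r_neq0 // powRr1 // le_max lexx.
by apply: ge0_ler_powR; rewrite ?nnegrE ?ler0n // ltW.
Qed.

End Powers.

Section ExceptionalBounds.
Variable R : realType.
Implicit Types (a s u : R) (n N : nat).

(** The losses in the reductions, constants included, are powers of
   [p `^ delta], so a bound that tolerates some [delta] gives one for the next
   dimension that tolerates a smaller one. *)
Definition exceptional_bound n N a s u : Prop :=
  exists2 delta : R, 0 < delta & exists p0 : nat,
  forall p : nat, prime p -> (p0 <= p)%N ->
  forall (I : finType) (E : {set I}) (A : {set 'rV['F_p]_n})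
    (V : I -> {vspace 'rV['F_p]_n}) (Y : I -> {set 'rV['F_p]_n}),
  shading N (p%:R `^ delta) (p%:R `^ a) (p%:R `^ s) A E V Y ->
  #|E|%:R <= p%:R `^ u.

Lemma exceptional_bound_le n N a s u u' :
  u <= u' -> exceptional_bound n N a s u -> exceptional_bound n N a s u'.
Proof.
move=> uu [d d0 [p0 h]]; exists d => //; exists p0 => p pp p0p I E A V Y sh.
apply: le_trans (h p pp p0p I E A V Y sh) _.
by apply: ler_powR => //; rewrite ler1n prime_gt0.
Qed.

Lemma card_le_projection (F : finFieldType) n (V : {vspace 'rV[F]_n})
    (Y : {set 'rV[F]_n}) :
  (#|Y| <= #|projection V Y| * #|F| ^ \dim V)%N.
Proof.
rewrite -sum_nat_const -sum1_card (partition_big_imset (coset V)) /=.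
apply: leq_sum => c /imsetP[x xY ->]; rewrite sum1_card -card_vspace.
rewrite -(card_imset (mem V) (addrI x)).
apply/subset_leq_card/subsetP => y; rewrite unfold_in => /andP[_ /eqP e].
have : y \in coset V x by rewrite -e mem_coset subrr mem0v.
by [].
Qed.

(** A projection is nonempty, and has at least [#|Y| / p ^ N] points. *)
Lemma exceptional_bound_empty n N a s u :
  s < Num.max 0 (a - N%:R) -> exceptional_bound n N a s u.
Proof.
move=> hs; pose d := (Num.max 0 (a - N%:R) - s) / 4.
have d0 : 0 < d by rewrite divr_gt0 // subr_gt0.
exists d => //; exists 0%N => p pp _ I E A V Y [_ h1 h2 h3].
have p1 : 1 < p%:R :> R by rewrite ltr1n prime_gt1.
have p0 : 0 < p%:R :> R by lra.
have Q0 : 0 < p%:R `^ d by apply: powR_gt0.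
suff -> : E = set0 by rewrite cards0 powR_ge0.
apply/eqP; apply: contraT => /set0Pn[i /h3[d1 _ d3 d4]]; exfalso.
have k1 : p%:R `^ a <= (p%:R `^ d) ^+ 3 * p%:R `^ s * p%:R `^ N%:R.
  apply: (le_trans h1).
  have := card_le_projection (V i) (Y i); rewrite d1 card_Fp // => k.
  have := ler_wpM2l (ltW Q0) d3.
  move/le_trans; apply.
  apply: le_trans (_ : p%:R `^ d * (p%:R `^ d *
      (#|projection (V i) (Y i)|%:R * p%:R ^+ N)) <= _).
    by rewrite !ler_wpM2l ?(ltW Q0) // -natrX -natrM ler_nat.
  rewrite powR_mulrn ?(ltW p0) //.
  apply: le_trans (_ : p%:R `^ d * (p%:R `^ d *
      (p%:R `^ d * p%:R `^ s * p%:R ^+ N)) <= _).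
    by rewrite !ler_wpM2l ?ler_wpM2r ?exprn_ge0 ?(ltW p0) ?(ltW Q0).
  by rewrite le_eqVlt; apply/orP; left; apply/eqP; ring.
have k2 : 1 <= p%:R `^ d * p%:R `^ s.
  apply: le_trans d4; rewrite ler1n card_gt0; apply/set0Pn.
  have : 0 < #|Y i|%:R :> R.
    rewrite -(pmulr_rgt0 _ Q0); apply: lt_le_trans d3.
    by rewrite -(pmulr_rgt0 _ Q0); apply: lt_le_trans h1; apply: powR_gt0.
  rewrite ltr0n => /card_gt0P[x xY].
  by exists (coset (V i) x); apply: imset_f.
have l2 : 0 <= d + s.
  by apply: (powR_le_inv p1); rewrite powRr0 powR_add.
have l1 : a <= d * 3%:R + s + N%:R.
  by apply: (powR_le_inv p1); rewrite !powR_add // -powR_mulnX // ltW.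
have dE : 4 * d = Num.max 0 (a - N%:R) - s by rewrite /d; lra.
move: dE; case: leP => _ dE; lra.
Qed.

Lemma powR_subr1 p a : 0 < p -> p `^ (a - 1) = p `^ a / p :> R.
Proof.
by move=> p0; rewrite powR_add // powRN powRr1 // ltW.
Qed.

(** The asymptotic form of [step_slice_containing].  Concentrated subspaces are
   exceptional with exponent [1 - d1], whence the hypothesis on [s0 < 1]. *)
Lemma slice_containing_bound n N a s u u' u'' : (N <= n)%N ->
  exceptional_bound n N (a - 1) (s - 1) u ->
  (forall s0, s0 < 1 -> exceptional_bound n.+1 N a s0 u') ->
  u + N%:R < u'' -> u' < u'' -> exceptional_bound n.+1 N a s u''.
Proof.
move=> Nn [dP dP0 [pP hP]] hc hu hu'.
pose eta := Num.min dP (Num.min (u'' - u - N%:R) (u'' - u')).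
have [e1 e2 e3] : [/\ eta <= dP, eta <= u'' - u - N%:R & eta <= u'' - u'].
  by rewrite /eta !ge_min !lexx !orbT.
have eta0 : 0 < eta by rewrite /eta !lt_min dP0 /=; apply/andP; split; lra.
(* The total loss is at most [p `^ (8 * d1)]. *)
pose d1 := eta / 8; have d10 : 0 < d1 by rewrite divr_gt0.
have d1E : eta = 8 * d1 by rewrite /d1; lra.
have [|d0 d00 [p0 h0]] := hc (1 - d1); first by lra.
pose d := Num.min (d0 / 2) d1.
have [f1 f2] : d <= d0 / 2 /\ d <= d1 by rewrite /d !ge_min !lexx !orbT.
have dd : 0 < d by rewrite /d lt_min d10 divr_gt0.
have [pK hK] := powR_large (4 * (64 * 4 * 2 ^+ 5)) d10.
have [p2 h2] := powR_large 2 dd.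
exists d => //; exists (maxn (maxn pP p0) (maxn pK p2)) => p pp.
rewrite !geq_max => /andP[/andP[gP g0] /andP[gK g2]] I E A V Y sh.
have p1 : 1 < p%:R :> R by rewrite ltr1n prime_gt1.
have pp0 : 0 < p%:R :> R by lra.
have le_p r s' : r <= s' -> p%:R `^ r <= p%:R `^ s' by apply/ler_powR/ltW.
have Q2 := h2 p g2; have QD := le_p _ _ f2.
have Q1 : 1 <= p%:R `^ d by lra.
have D1 : 1 <= p%:R `^ d1 by lra.
have {hK} KD := hK p gK.
have [E1 [E2 [Y1 [-> sh1 sh2]]]] := step_slice_containing Nn Q1 D1
  (powR_gt0 a pp0) (powR_gt0 s pp0) sh.
have cE1 : #|E1|%:R <= p%:R `^ u'.
  have eD : p%:R `^ (1 - d1) = #|'F_p|%:R / p%:R `^ d1.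
    by rewrite card_Fp // powR_add // powRN powRr1 // ltW.
  apply: (h0 p pp g0 I E1 A V Y1); rewrite eD; apply: shading_weaken sh1.
  - apply: le_trans (_ : p%:R `^ (d + d) <= _); last by apply: le_p; lra.
    by rewrite powR_add // ler_wpM2r ?powR_ge0.
  - exact: powR_ge0.
  - by rewrite divr_ge0 ?powR_ge0.
have cE2 : #|E2|%:R <= p%:R `^ (N%:R + d1 * 7%:R + u).
  have [->|E20] := eqVneq E2 set0; first by rewrite cards0 powR_ge0.
  have [E' [A' [V' [Y' [k1 k2]]]]] := sh2 E20.
  set Q' := 4 * _ in k1 k2.
  have Q'D : Q' <= p%:R `^ (d1 * 7%:R).
    rewrite -powR_mulnX ?(ltW pp0) //.
    move: Q1 QD D1 KD; rewrite /Q'; clear.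
    move: (p%:R `^ d) (p%:R `^ d1) => Q D Q1 QD D1 KD.
    have -> : 4 * (64 * (4 * D) * (2 * Q) ^+ 5) =
      4 * (64 * 4 * 2 ^+ 5) * (D * Q ^+ 5) by ring.
    rewrite [D ^+ 7]exprS [D ^+ 6]exprS ler_pM //.
    - by rewrite !mulr_ge0 // exprn_ge0.
    - by rewrite mulr_ge0 ?exprn_ge0 //; lra.
    - by rewrite ler_wpM2l ?lerXn2r ?nnegrE //; lra.
  apply: (le_trans k1); rewrite card_Fp // -powR_mulrn ?(ltW pp0) //.
  rewrite !powR_add // -mulrA ler_wpM2l ?powR_ge0 //.
  apply: ler_pM; rewrite ?ler0n //.
    by rewrite /Q' !mulr_ge0 ?exprn_ge0 // ?mulr_ge0 ?powR_ge0.
  have eF (r : R) : p%:R `^ (r - 1) = p%:R `^ r / #|'F_p|%:R.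
    by rewrite card_Fp // powR_subr1.
  apply: (hP p pp gP I E' A' V' Y'); rewrite !eF; apply: shading_weaken k2.
  - apply: (le_trans Q'D); apply: le_p; lra.
  - by rewrite divr_ge0 ?powR_ge0.
  - by rewrite divr_ge0 ?powR_ge0.
apply: le_trans (_ : #|E1|%:R + #|E2|%:R <= _).
  by rewrite -natrD ler_nat leq_card_setU.
have x1 : #|E1|%:R <= p%:R `^ (u'' - d1).
  by apply: (le_trans cE1); apply: le_p; lra.
have x2 : #|E2|%:R <= p%:R `^ (u'' - d1).
  by apply: (le_trans cE2); apply: le_p; lra.
have -> : p%:R `^ u'' = p%:R `^ d1 * p%:R `^ (u'' - d1).
  by rewrite -powR_add // addrC subrK.
apply: le_trans (_ : 2 * p%:R `^ (u'' - d1) <= _); first by lra.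
by rewrite ler_wpM2r ?powR_ge0 //; lra.
Qed.

(** The asymptotic form of [step_project_inside].  Concentrated subspaces are
   exceptional with exponent [a - N - d1], whence the hypothesis on [s0]. *)
Lemma project_inside_bound n N a s u u' u'' : (N <= n)%N ->
  exceptional_bound n N a s u ->
  (forall s0, s0 < a - N%:R -> exceptional_bound n.+1 N.+1 a s0 u') ->
  u + (n - N)%:R < u'' -> u' < u'' -> exceptional_bound n.+1 N.+1 a s u''.
Proof.
move=> Nn [dP dP0 [pP hP]] hc hu hu'.
pose eta := Num.min dP (Num.min (u'' - u - (n - N)%:R) (u'' - u')).
have [e1 e2 e3] : [/\ eta <= dP, eta <= u'' - u - (n - N)%:R & eta <= u'' - u'].
  by rewrite /eta !ge_min !lexx !orbT.
have eta0 : 0 < eta by rewrite /eta !lt_min dP0 /=; apply/andP; split; lra.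
pose d1 := eta / 8; have d10 : 0 < d1 by rewrite divr_gt0.
have d1E : eta = 8 * d1 by rewrite /d1; lra.
have [|d0 d00 [p0 h0]] := hc (a - N%:R - d1); first by lra.
pose d := Num.min (d0 / 2) d1.
have [f1 f2] : d <= d0 / 2 /\ d <= d1 by rewrite /d !ge_min !lexx !orbT.
have dd : 0 < d by rewrite /d lt_min d10 divr_gt0.
have [pK hK] := powR_large 8 d10.
have [p2 h2] := powR_large 2 dd.
exists d => //; exists (maxn (maxn pP p0) (maxn pK p2)) => p pp.
rewrite !geq_max => /andP[/andP[gP g0] /andP[gK g2]] I E A V Y sh.
have p1 : 1 < p%:R :> R by rewrite ltr1n prime_gt1.
have pp0 : 0 < p%:R :> R by lra.
have le_p r s' : r <= s' -> p%:R `^ r <= p%:R `^ s' by apply/ler_powR/ltW.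
have Q2 := h2 p g2; have QD := le_p _ _ f2.
have Q1 : 1 <= p%:R `^ d by lra.
have D1 : 1 <= p%:R `^ d1 by lra.
have {hK} KD := hK p gK.
have [E1 [E2 [Y1 [-> sh1 sh2]]]] := step_project_inside Nn Q1 D1
  (powR_gt0 a pp0) (powR_gt0 s pp0) sh.
have cE1 : #|E1|%:R <= p%:R `^ u'.
  have eD : p%:R `^ (a - N%:R - d1) =
      p%:R `^ a / (#|'F_p|%:R ^+ N * p%:R `^ d1).
    rewrite card_Fp // -powR_mulrn ?ler0n // -powR_add // -powRN -powR_add //.
    by congr (_ `^ _); lra.
  apply: (h0 p pp g0 I E1 A V Y1); rewrite eD; apply: shading_weaken sh1.
  - apply: le_trans (_ : p%:R `^ (d + d) <= _); last by apply: le_p; lra.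
    by rewrite powR_add // ler_wpM2r ?powR_ge0.
  - exact: powR_ge0.
  - by rewrite divr_ge0 ?mulr_ge0 ?exprn_ge0 ?powR_ge0.
have cE2 : #|E2|%:R <= p%:R `^ (d1 + (n - N)%:R + u).
  have [->|E20] := eqVneq E2 set0; first by rewrite cards0 powR_ge0.
  have [E' [A' [V' [Y' [k1 k2]]]]] := sh2 E20.
  have Q'D : 8 * p%:R `^ d1 * p%:R `^ d ^+ 2 <= p%:R `^ (d1 * 4%:R).
    rewrite -powR_mulnX ?(ltW pp0) //.
    move: Q1 QD D1 KD; clear.
    move: (p%:R `^ d) (p%:R `^ d1) => Q D Q1 QD D1 KD.
    rewrite (exprD D 2 2) [D ^+ 2 in X in _ <= X * _]expr2 ler_pM //.
    - by rewrite mulr_ge0 //; lra.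
    - by rewrite exprn_ge0 //; lra.
    - by rewrite ler_wpM2r //; lra.
    - by rewrite lerXn2r ?nnegrE //; lra.
  apply: (le_trans k1); rewrite card_Fp // -powR_mulrn ?(ltW pp0) //.
  rewrite !powR_add //.
  apply: ler_pM; rewrite ?ler0n ?mulr_ge0 ?powR_ge0 //.
    by rewrite ler_wpM2r ?powR_ge0 //; lra.
  apply: (hP p pp gP I E' A' V' Y'); apply: shading_weaken k2.
  - apply: (le_trans Q'D); apply: le_p; lra.
  - exact: powR_ge0.
  - exact: powR_ge0.
apply: le_trans (_ : #|E1|%:R + #|E2|%:R <= _).
  by rewrite -natrD ler_nat leq_card_setU.
have x1 : #|E1|%:R <= p%:R `^ (u'' - d1).
  by apply: (le_trans cE1); apply: le_p; lra.
have x2 : #|E2|%:R <= p%:R `^ (u'' - d1).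
  by apply: (le_trans cE2); apply: le_p; lra.
have -> : p%:R `^ u'' = p%:R `^ d1 * p%:R `^ (u'' - d1).
  by rewrite -powR_add // addrC subrK.
apply: le_trans (_ : 2 * p%:R `^ (u'' - d1) <= _); first by lra.
by rewrite ler_wpM2r ?powR_ge0 //; lra.
Qed.

(** Resolves the conclusion of [select_separating]. *)
Lemma separated_bound (p e z : R) : 0 < p -> 0 <= e ->
  p * e <= 16 * (p + e) * z -> 32 * z <= p -> e <= 32 * z.
Proof.
move=> p0 e0 h1 h2; rewrite -(ler_pM2l p0).
have := ler_wpM2l e0 h2; lra.
Qed.

(** As [u < 1], a family of more than [p `^ u'] subspaces would have more than
   [p `^ u] distinct traces on a suitable hyperplane. *)
Lemma slice_generic_bound n N a s u u' : (0 < N)%N -> 1 <= a -> u < 1 ->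
  u < u' -> exceptional_bound n N (a - 1) s u ->
  exceptional_bound n.+1 N.+1 a s u'.
Proof.
move=> N0 a1 u1 uu [dP dP0 [pP hP]].
pose eta := Num.min dP (Num.min (1 - u) (u' - u)).
have [e1 e2 e3] : [/\ eta <= dP, eta <= 1 - u & eta <= u' - u].
  by rewrite /eta !ge_min !lexx !orbT.
have eta0 : 0 < eta by rewrite /eta !lt_min dP0 /=; apply/andP; split; lra.
pose d := eta / 8; have d0 : 0 < d by rewrite divr_gt0.
have dE : eta = 8 * d by rewrite /d; lra.
have [pK hK] := powR_large (64 * 8) d0.
exists d => //; exists (maxn pP (maxn pK 8)) => p pp.
rewrite !geq_max => /andP[gP /andP[gK g8]] I E A V Y sh.
have p1 : 1 < p%:R :> R by rewrite ltr1n prime_gt1.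
have pp0 : 0 < p%:R :> R by lra.
have le_p r s' : r <= s' -> p%:R `^ r <= p%:R `^ s' by apply/ler_powR/ltW.
have KQ := hK p gK.
have Q1 : 1 <= p%:R `^ d by lra.
have [->|E0] := eqVneq E set0; first by rewrite cards0 powR_ge0.
have p8 : 8 <= #|'F_p|%:R :> R by rewrite card_Fp // (ler_nat R 8).
have pal : #|'F_p|%:R <= p%:R `^ a.
  by rewrite card_Fp // -{1}(powRr1 (ltW pp0)) le_p.
have [E' [A' [V' [Y' [k1 k2]]]]] :=
  step_slice_generic p8 N0 Q1 pal (powR_gt0 s pp0) E0 sh.
set Q' := 64 * _ * _ in k1 k2.
have Q'D : Q' <= p%:R `^ (d * 7%:R).
  rewrite -powR_mulnX ?(ltW pp0) // /Q'.
  move: (p%:R `^ d) KQ Q1; clear => Q KQ Q1.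
  have -> : 64 * (8 * Q) * Q ^+ 5 = (64 * 8) * Q ^+ 6 by ring.
  by rewrite [Q ^+ 7]exprS ler_wpM2r ?exprn_ge0 //; lra.
have eF (r : R) : p%:R `^ (r - 1) = p%:R `^ r / #|'F_p|%:R.
  by rewrite card_Fp // powR_subr1.
have cE' : #|E'|%:R <= p%:R `^ u.
  apply: (hP p pp gP I E' A' V' Y'); rewrite !eF; apply: shading_weaken k2.
  - by apply: (le_trans Q'D); apply: le_p; lra.
  - by rewrite divr_ge0 ?powR_ge0.
  - exact: powR_ge0.
have hz : 32 * (Q' * #|E'|%:R) <= p%:R `^ (d * 8%:R + u).
  apply: le_trans (_ : p%:R `^ d * (p%:R `^ (d * 7%:R) * p%:R `^ u) <= _).
    apply: ler_pM => //; last 1 first.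
    - by apply: ler_pM => //; rewrite /Q' !mulr_ge0 ?exprn_ge0 ?powR_ge0.
    - by rewrite mulr_ge0 // /Q' !mulr_ge0 ?exprn_ge0 ?powR_ge0.
    - by lra.
  by rewrite -!powR_add // le_p //; lra.
rewrite card_Fp // in k1.
have h2 : 32 * (Q' * #|E'|%:R) <= p%:R.
  apply: (le_trans hz); rewrite -{2}(powRr1 (ltW pp0)); apply: le_p; lra.
apply: (le_trans (separated_bound pp0 _ k1 h2)) => //.
by apply: (le_trans hz); apply: le_p; lra.
Qed.

Lemma project_generic_bound n N a s u u' : (N < n)%N -> a <= n%:R -> u < 1 ->
  u < u' -> exceptional_bound n N a s u ->
  exceptional_bound n.+1 N a s u'.
Proof.
move=> Nn an u1 uu [dP dP0 [pP hP]].
pose eta := Num.min dP (Num.min (1 - u) (u' - u)).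
have [e1 e2 e3] : [/\ eta <= dP, eta <= 1 - u & eta <= u' - u].
  by rewrite /eta !ge_min !lexx !orbT.
have eta0 : 0 < eta by rewrite /eta !lt_min dP0 /=; apply/andP; split; lra.
pose d := eta / 8; have d0 : 0 < d by rewrite divr_gt0.
have dE : eta = 8 * d by rewrite /d; lra.
have [pK hK] := powR_large 32 d0.
exists d => //; exists (maxn pP (maxn pK 8)) => p pp.
rewrite !geq_max => /andP[gP /andP[gK g8]] I E A V Y sh.
have p1 : 1 < p%:R :> R by rewrite ltr1n prime_gt1.
have pp0 : 0 < p%:R :> R by lra.
have le_p r s' : r <= s' -> p%:R `^ r <= p%:R `^ s' by apply/ler_powR/ltW.
have KQ := hK p gK.
have Q1 : 1 <= p%:R `^ d by lra.
have [->|E0] := eqVneq E set0; first by rewrite cards0 powR_ge0.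
have p8 : 8 <= #|'F_p|%:R :> R by rewrite card_Fp // (ler_nat R 8).
have pal : p%:R `^ a <= #|'F_p|%:R ^+ n.
  by rewrite card_Fp // -powR_mulrn ?(ltW pp0) // le_p.
have [E' [A' [V' [Y' [k1 k2]]]]] :=
  step_project_generic p8 Nn Q1 (powR_gt0 a pp0) pal (powR_gt0 s pp0) E0 sh.
have Q'D : 8 * p%:R `^ d ^+ 4 <= p%:R `^ (d * 5%:R).
  rewrite -powR_mulnX ?(ltW pp0) //.
  by rewrite [_ ^+ 5]exprS ler_wpM2r ?exprn_ge0 ?powR_ge0 //; lra.
have cE' : #|E'|%:R <= p%:R `^ u.
  apply: (hP p pp gP I E' A' V' Y'); apply: shading_weaken k2.
  - by apply: (le_trans Q'D); apply: le_p; lra.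
  - exact: powR_ge0.
  - exact: powR_ge0.
have hz : 32 * #|E'|%:R <= p%:R `^ (d + u).
  by rewrite powR_add // ler_pM.
rewrite card_Fp // in k1.
have h2 : 32 * #|E'|%:R <= p%:R :> R.
  apply: (le_trans hz); rewrite -{2}(powRr1 (ltW pp0)); apply: le_p; lra.
apply: (le_trans (separated_bound pp0 _ k1 h2)) => //.
by apply: (le_trans hz); apply: le_p; lra.
Qed.

End ExceptionalBounds.

(** * The plane: point-line duality *)

Lemma subset_of_card (T : finType) (A : {set T}) m : (m <= #|A|)%N ->
  exists2 B : {set T}, B \subset A & #|B| = m.
Proof.
move=> mA; exists [set x in take m (enum A)].
  by apply/subsetP => x; rewrite inE => /mem_take; rewrite mem_enum.
rewrite cardsE; have /card_uniqP -> := take_uniq m (enum_uniq A).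
by rewrite size_takel // -cardE.
Qed.

Lemma card_bigcup_le (T J : finType) (E : {set J}) (G : J -> {set T}) :
  (#|\bigcup_(i in E) G i| <= \sum_(i in E) #|G i|)%N.
Proof.
elim/big_rec2: _ => [|i m B _ h]; first by rewrite cards0.
by apply: leq_trans (leq_card_setU _ _) _; rewrite leq_add2l.
Qed.

Lemma card_imset_coarser (T T1 T2 : finType) (g1 : T -> T1) (g2 : T -> T2)
    (A : {set T}) : {in A &, forall x y, g1 x = g1 y -> g2 x = g2 y} ->
  (#|g2 @: A| <= #|g1 @: A|)%N.
Proof.
move=> h; have [B [sB inj <-]] := transversal_imset g2 A.
rewrite -(card_in_imset (_ : {in B &, injective g1})).
  by apply/subset_leq_card/imsetS.
by move=> x y xB yB e; apply: inj => //; apply: h => //; apply: (subsetP sB).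
Qed.

Section PointLine.
Variable F : finFieldType.
Implicit Types (c : F) (x y w : 'rV[F]_2) (U V : {vspace 'rV[F]_2}).

Definition vec2 (b c : F) : 'rV[F]_2 := \row_j (if j == 0 then b else c).

Lemma vec2P x : x = vec2 (x 0 0) (x 0 1).
Proof.
apply/rowP => j; rewrite mxE; case: eqP => [->//|/eqP].
by case: j => [[|[|//]] jj] // _; congr (x 0 _); apply: val_inj.
Qed.

Lemma vec2_inj b c b' c' : vec2 b c = vec2 b' c' -> b = b' /\ c = c'.
Proof.
by move=> /rowP e; split; [have := e 0|have := e 1]; rewrite !mxE.
Qed.

(** The point [x] is dual to the line of all [(c, d)] such that [x] lies on the
   line of slope [c] and intercept [d]. *)
Definition dual_point c x := vec2 c (x 0 1 - c * x 0 0).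
Definition dual_line x := [set dual_point c x | c : F].

Lemma dual_line_is_line x : is_line (dual_line x).
Proof.
pose w := vec2 1 (- x 0 0); exists <[w]>%VS, (vec2 0 (x 0 1)); split.
  rewrite inE dim_vline; suff -> : w != 0 by [].
  by apply/eqP => /rowP/(_ 0); rewrite !mxE /=; apply/eqP/oner_neq0.
apply/setP => y; rewrite mem_coset; apply/imsetP/vlineP => -[c].
  move=> _ ->; exists c; apply/rowP => j; rewrite !mxE.
  by case: (j == 0); ring.
move=> e; exists c => //; rewrite -[y](subrK (vec2 0 (x 0 1))) e.
by apply/rowP => j; rewrite !mxE; case: (j == 0); ring.
Qed.

Lemma dual_line_inj : injective dual_line.
Proof.
move=> x y e; have p c : exists c', dual_point c x = dual_point c' y.
  have : dual_point c x \in dual_line x by apply: imset_f.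
  by rewrite e => /imsetP[c' _ ->]; exists c'.
have [c0 /vec2_inj[e0 e0']] := p 0; have [c1 /vec2_inj[e1 e1']] := p 1.
rewrite -e0 !mul0r !subr0 in e0'; rewrite -e1 !mul1r e0' in e1'.
by rewrite (vec2P x) (vec2P y) e0' (oppr_inj (addrI _ e1')).
Qed.

Definition vertical V := vpick V 0 0 == 0.
Definition slope V := vpick V 0 1 / vpick V 0 0.

Lemma vlineE V : \dim V = 1%N -> V = <[vpick V]>%VS.
Proof.
move=> d; apply/eqP; rewrite eq_sym eqEdim -memvE memv_pick d dim_vline.
by rewrite vpick0 -dimv_eq0 d.
Qed.

Lemma vertical_line V : \dim V = 1%N -> vertical V -> V = <[(vec2 0 1)%R]>%VS.
Proof.
move=> d /eqP v0; have e := vlineE d.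
have w : vpick V = vpick V 0 1 *: vec2 0 1.
  by rewrite {1}[vpick V]vec2P v0; apply/rowP => j; rewrite !mxE;
    case: (j == 0); rewrite ?mulr0 ?mulr1.
apply/eqP; rewrite eqEdim d {1}e -memvE w memvZ ?memv_line //=.
by rewrite dim_vline leq_b1.
Qed.

Lemma nonvertical_line V : \dim V = 1%N -> ~~ vertical V ->
  V = <[(vec2 1 (slope V))%R]>%VS.
Proof.
move=> d v0; have e := vlineE d.
have w : vpick V = vpick V 0 0 *: vec2 1 (slope V).
  rewrite {1}[vpick V]vec2P; apply/rowP => j; rewrite !mxE.
  by case: (j == 0); rewrite ?mulr1 // /slope mulrC divfK.
apply/eqP; rewrite eqEdim d {1}e -memvE w memvZ ?memv_line //=.
by rewrite dim_vline leq_b1.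
Qed.

Lemma dual_point_coset V x y : \dim V = 1%N -> ~~ vertical V -> x - y \in V ->
  dual_point (slope V) x = dual_point (slope V) y.
Proof.
move=> d v0; rewrite {1}(nonvertical_line d v0) => /vlineP[c e].
rewrite /dual_point -[x](subrK y) e; congr vec2; rewrite !mxE /=; ring.
Qed.

(** Duality turns a set [A] of points and directions along which it projects to
   few cosets into a Furstenberg configuration: points become lines, and on the
   line dual to [x] the marked points are the dual points of the [V i] with
   [x \in Y i].  Two points in the same coset of [V i] have the same dual point
   of slope [V i], so there are few marked points in total.  Only the points of
   [A] that lie in many [Y i] are kept. *)
Lemma dual_configuration (R : realFieldType) (I : finType) (E : {set I})
    (A : {set 'rV[F]_2}) (V : I -> {vspace 'rV[F]_2}) (Y : I -> {set 'rV[F]_2})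
    (Q K : R) :
  1 <= Q -> E != set0 -> {in E &, injective V} ->
  (forall i, i \in E -> [/\ \dim (V i) = 1%N, ~~ vertical (V i), Y i \subset A,
     #|A|%:R <= Q * #|Y i|%:R & #|projection (V i) (Y i)|%:R <= K]) ->
  exists (L : {set {set 'rV[F]_2}}) (Z : {set 'rV[F]_2} -> {set 'rV[F]_2}),
    [/\ forall l, l \in L -> is_line l, #|A|%:R <= 2 * Q * #|L|%:R,
      forall l, l \in L -> Z l \subset l /\ #|E|%:R <= 2 * Q * #|Z l|%:R
    & #|\bigcup_(l in L) Z l|%:R <= #|E|%:R * K].
Proof.
move=> Q1 E0 inj hE; have Q0 : 0 < Q by lra.
have [m mE] : exists m : R, m = #|E|%:R by exists #|E|%:R.
have m0 : 0 < m by rewrite mE ltr0n card_gt0.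
have [q qE] : exists q : R, q = Q^-1 by exists Q^-1.
have q0 : 0 < q by rewrite qE invr_gt0.
have mq : m / (2 * Q) = m * q / 2 by rewrite qE; field; rewrite lt0r_neq0.
pose N x := #|[set i in E | x \in Y i]|%:R : R.
pose A0 := [set x in A | m / (2 * Q) <= N x].
have hA0 : #|A|%:R <= 2 * Q * #|A0|%:R.
  have sumN : \sum_(x in A) N x = \sum_(i in E) #|Y i|%:R.
    under eq_bigr => x _ do rewrite /N -sum1dep_card natr_sum.
    under [RHS]eq_bigr => i _ do rewrite -sum1_card natr_sum.
    rewrite (exchange_big_dep (mem E)) /=; last by move=> x i _ /andP[].
    apply: eq_bigr => i iE; apply: eq_bigl => x; rewrite iE /=.
    have [_ _ sY _ _] := hE i iE.
    by apply: andb_idl; apply: (subsetP sY).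
  have lo : m * q * #|A|%:R <= \sum_(x in A) N x.
    rewrite sumN mE -mulrA mulr_natl -sumr_const.
    by apply: ler_sum => i /hE[_ _ _ k _]; rewrite qE ler_pdivrMl.
  have hi : \sum_(x in A) N x <= m * #|A0|%:R + m * q / 2 * #|A|%:R.
    apply: le_trans (_ : \sum_(x in A) ((x \in A0)%:R * m + m * q / 2) <= _).
      apply: ler_sum => x xA; case: (boolP (x \in A0)) => xA0.
        rewrite mul1r; apply: ler_wpDr; first by rewrite divr_ge0 ?mulr_ge0 ?ltW.
        rewrite mE ler_nat subset_leq_card //.
        by apply/subsetP => i; case/setIdP.
      rewrite mul0r add0r; move: xA0; rewrite inE xA /= -ltNge mq.
      exact: ltW.
    rewrite big_split /= -mulr_suml sumr_const -[_ *+ #|A|]mulr_natr.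
    rewrite lerD2r mulrC ler_wpM2l ?(ltW m0) //.
    rewrite -[#|A0|]sum1_card natr_sum big_mkcond [leRHS]big_mkcond /=.
    by apply: ler_sum => x _; case: (x \in A); case: (x \in A0).
  have : m * q / 2 * #|A|%:R <= m * #|A0|%:R.
    by apply: (@le_trans _ _ (m * q * #|A|%:R - m * q / 2 * #|A|%:R)); lra.
  rewrite -!mulrA ler_pM2l // => k.
  by have := ler_wpM2l (ltW Q0) k; rewrite qE mulVKf ?lt0r_neq0 //; lra.
pose dp i := dual_point (slope (V i)).
pose Z (l : {set 'rV[F]_2}) :=
  \bigcup_(x in A0 | dual_line x == l)
     [set dp i x | i in [set i in E | x \in Y i]].
exists (dual_line @: A0), Z; split.
- by move=> l /imsetP[x _ ->]; apply: dual_line_is_line.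
- by rewrite (card_imset _ dual_line_inj).
- move=> l /imsetP[x xA0 ->]; split.
    apply/bigcupsP => y /andP[_ /eqP <-].
    by apply/subsetP => _ /imsetP[i _ ->]; apply: imset_f.
  apply: le_trans (_ : 2 * Q * N x <= _).
    case/setIdP: xA0 => _; rewrite ler_pdivrMr ?mulr_gt0 // -mE.
    by rewrite [N x * _]mulrC.
  rewrite ler_wpM2l ?mulr_ge0 ?(ltW Q0) // ler_nat.
  have inj_dp : {in [set i in E | x \in Y i] &, injective (dp^~ x)}.
    move=> i j /setIdP[iE _] /setIdP[jE _] /vec2_inj[e _].
    have [di vi _ _ _] := hE i iE; have [dj vj _ _ _] := hE j jE.
    apply: inj => //.
    by rewrite (nonvertical_line di vi) (nonvertical_line dj vj) e.
  rewrite -(card_in_imset inj_dp); apply/subset_leq_card/subsetP => y yS.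
  by apply/bigcupP; exists x; rewrite ?xA0 ?eqxx.
apply: le_trans (_ : \sum_(i in E) #|dp i @: Y i|%:R <= _).
  rewrite -natr_sum ler_nat; apply: leq_trans (card_bigcup_le _ _).
  apply/subset_leq_card/bigcupsP => l _; apply/bigcupsP => x _.
  apply/subsetP => _ /imsetP[i /setIdP[iE xY] ->].
  by apply/bigcupP; exists i => //; apply: imset_f.
rewrite mulr_natl -sumr_const; apply: ler_sum => i /hE[di vi _ _].
apply: le_trans; rewrite ler_nat; apply: card_imset_coarser => x y _ _ /eqP.
by rewrite coset_eq; apply: dual_point_coset.
Qed.

End PointLine.

(** The dual configuration of a set [A] of size [p `^ a] and of [p `^ u]
   directions has [p `^ a] lines with [p `^ u] points each, and at most
   [p `^ (u + s)] points in total; the conjecture allows this only if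
   [s >= a], [s >= 1] or [2 * s >= u + a], up to an arbitrarily small loss. *)
Lemma planar_bound (R : realType) (a s u : R) :
  planar_furstenberg_conjecture R -> 0 < a <= 2 -> s < Num.min a 1 ->
  Num.max (2 * s - a) 0 < u < 1 -> exceptional_bound 2 1 a s u.
Proof.
move=> furstenberg /andP[a0 a2]; rewrite lt_min => /andP[sa s1].
rewrite gt_max => /andP[/andP[su u0] u1].
(* The gap between [s] and what the conjecture gives for its exponents close to
   [u] and [a]. *)
have [g [g0 gu ga [g1 g2 g3]]] : exists g, [/\ 0 < g, g <= u, g <= a &
    [/\ s + g <= a, s + g <= 1 & s + g <= (u + a) / 2]].
  exists (Num.min (Num.min (a - s) (1 - s))
    (Num.min ((u + a) / 2 - s) (Num.min u a))).
  set g := Num.min _ _.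
  have [h1 h2 [h3 h4 h5]] : [/\ g <= a - s, g <= 1 - s &
      [/\ g <= (u + a) / 2 - s, g <= u & g <= a]].
    by rewrite /g !ge_min !lexx !orbT.
  split=> //; last by split; lra.
  by rewrite /g !lt_min u0 a0 !andbT -!andbA; apply/and3P; split; lra.
have [d dE] : exists d, g = 20 * d by exists (g / 20); lra.
have d0 : 0 < d by lra.
pose mn := Num.min (u - 3 * d + (a - 4 * d))
  (Num.min (3 / 2 * (u - 3 * d) + 1 / 2 * (a - 4 * d)) (u - 3 * d + 1)).
have hmn : u + d + s + d <= mn - d.
  by rewrite lerBrDr /mn !le_min; apply/and3P; split; lra.
have [||||c c0 hc] := furstenberg (u - 3 * d) (a - 4 * d) 1 d.
- by apply/andP; split; lra.
- by apply/andP; split; lra.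
- by rewrite ltr01 lexx.
- by [].
have [pK hK] := powR_large (Num.max 2 (2 / c)) d0.
exists d => //; exists pK => p pp pKp I E A V Y [inj h1 h2 h3].
have p1 : 1 < p%:R :> R by rewrite ltr1n prime_gt1.
have pp0 : 0 < p%:R :> R by apply: lt_trans p1.
have le_p (r s' : R) : r <= s' -> p%:R `^ r <= p%:R `^ s' by apply/ler_powR/ltW.
have [Q2 Qc] : 2 <= p%:R `^ d /\ 2 / c <= p%:R `^ d.
  by have := hK p pKp; rewrite ge_max => /andP[].
have Q0 := powR_gt0 d pp0; have Q1 : 1 <= p%:R `^ d by apply: le_trans Q2; lra.
rewrite leNgt; apply/negP => hE.
(* The bound on the number of marked points is proportional to the number of
   directions, so [E] is cut down to about [p `^ u] of them; the one without a
   slope is dropped. *)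
have [m mE] : exists m, m = Num.truncn (p%:R `^ u) by eexists; reflexivity.
have /andP[m1 m2] := truncn_itv (powR_ge0 p%:R u); rewrite -mE in m1 m2.
pose E1 := [set i in E | ~~ vertical (V i)].
have [E0 sE0 cE0] : exists2 E0 : {set I}, E0 \subset E1 & #|E0| = m.
  apply: subset_of_card.
  have mltE : (m < #|E|)%N by rewrite -(ltr_nat R); apply: le_lt_trans hE.
  rewrite -ltnS; apply: (leq_trans mltE); rewrite -(addn1 #|E1|).
  have -> : E1 = E :\: [set i in E | vertical (V i)].
    by apply/setP => i; rewrite !inE; case: (i \in E); rewrite ?andbF ?andbT.
  rewrite -(cardsID [set i in E | vertical (V i)] E) addnC leq_add2l.
  rewrite -(card_in_imset (f := fun=> tt)).
    by apply: leq_trans (max_card _) _; rewrite card_unit.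
  move=> i j /setIP[_ /setIdP[iE vi]] /setIP[_ /setIdP[jE vj]] _.
  have [di _ _ _] := h3 i iE; have [dj _ _ _] := h3 j jE.
  by apply: inj => //; rewrite (vertical_line di vi) (vertical_line dj vj).
have u2 : 2 <= p%:R `^ u by apply: (le_trans Q2); apply: le_p; clear -dE gu d0; lra.
have m3 : p%:R `^ u <= 2 * #|E0|%:R.
  by rewrite cE0; move: m2 u2; rewrite -natr1; clear; lra.
have [|i j iE jE|i iE|L [Z [lineL cL hZ hU]]] :=
    @dual_configuration _ R I E0 A V Y (p%:R `^ d) (p%:R `^ d * p%:R `^ s) Q1.
- by rewrite -card_gt0 -(ltr0n R); move: m3 u2; clear; lra.
- have /setIdP[iE1 _] := subsetP sE0 i iE; have /setIdP[jE1 _] := subsetP sE0 j jE.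
  exact: inj.
- by have /setIdP[iE1 vi] := subsetP sE0 i iE; have [d1 d2 d3 d4] := h3 i iE1.
have {hc} := hc p pp L Z lineL; rewrite -/mn mul1r => big.
have QQ : 2 * p%:R `^ d <= p%:R `^ d * p%:R `^ d by rewrite ler_wpM2r // ltW.
have QQQ : 4 * p%:R `^ d <= p%:R `^ d * p%:R `^ d * p%:R `^ d.
  have : 2 * p%:R `^ d * 2 <= p%:R `^ d * p%:R `^ d * p%:R `^ d.
    by apply: ler_pM => //; rewrite mulr_ge0 // ltW.
  by move: (p%:R `^ d * p%:R `^ d * p%:R `^ d); clear => X; lra.
have {big} low : c * p%:R `^ (mn - d) <= #|\bigcup_(l in L) Z l|%:R.
  apply: big.
    rewrite -(ler_pM2l (_ : 0 < 2 * p%:R `^ d)) ?mulr_gt0 //.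
    apply: le_trans cL; rewrite -(ler_pM2l Q0); apply: le_trans h1.
    rewrite mulrA.
    apply: le_trans (_ : p%:R `^ d * (p%:R `^ d * p%:R `^ d) *
        p%:R `^ (a - 4 * d) <= _).
      by rewrite ler_wpM2r ?powR_ge0 // ler_wpM2l // ltW.
    by rewrite -!powR_add // le_p //; clear -d0; lra.
  move=> l /hZ[sZ hl]; split=> //; rewrite mul1r.
  rewrite -(ler_pM2l (_ : 0 < 2 * (2 * p%:R `^ d))) ?mulr_gt0 //.
  rewrite -[leRHS]mulrA; apply: le_trans (ler_wpM2l (ler0n R 2) hl).
  apply: le_trans m3.
  have -> : 2 * (2 * p%:R `^ d) = 4 * p%:R `^ d by ring.
  apply: le_trans (ler_wpM2r (powR_ge0 _ _) QQQ) _.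
  by rewrite -!powR_add // le_p //; clear -d0; lra.
have up : #|\bigcup_(l in L) Z l|%:R <= p%:R `^ (u + d + s).
  apply: (le_trans hU); rewrite cE0 -powR_add // -addrA [leRHS]powR_add //.
  by rewrite ler_wpM2r ?powR_ge0.
have : c * p%:R `^ (u + d + s + d) <= p%:R `^ (u + d + s).
  apply: le_trans up; apply: le_trans low.
  by rewrite ler_wpM2l ?(ltW c0) // le_p.
rewrite powR_add //; have := powR_gt0 (u + d + s) pp0.
have : 2 <= c * p%:R `^ d by rewrite -ler_pdivrMl // mulrC.
move: (p%:R `^ (u + d + s)) (p%:R `^ d); clear => X Q k X0; apply/negP.
by rewrite -ltNge; have := ler_wpM2r (ltW X0) k; lra.
Qed.

(** * From the plane to arbitrary dimensions *)

Section Assembly.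
Variable R : realType.
Hypothesis furstenberg : planar_furstenberg_conjecture R.
Implicit Types (a b s u : R) (n N k q j l : nat).

Definition planar_range b s u : Prop :=
  [/\ 0 < b <= 2, s < Num.min b 1 & Num.max (2 * s - b) 0 < u < 1].

(** The open range of [u] leaves room to lose a little at every step. *)
Lemma planar_range_open b s u : planar_range b s u ->
  exists2 v, v < u & planar_range b s v.
Proof.
move=> [hb hs /andP[h1 h2]]; exists ((Num.max (2 * s - b) 0 + u) / 2).
  by lra.
by split=> //; apply/andP; split; lra.
Qed.

(** Lines in a space of any dimension: generic projections lead to the plane,
   where a set of size [p `^ b] with [b <= 2] still fits. *)
Lemma line_bound k b s u : planar_range b s u ->
  exceptional_bound k.+2 1 b s u.
Proof.
elim: k u => [|k IH] u hu; first by case: hu => *; apply: planar_bound.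
have [v vu hv] := planar_range_open hu.
apply: project_generic_bound vu (IH v hv) => //.
  by case: hu => /andP[_ b2] _ _; apply: (le_trans b2); rewrite ler_nat.
by case: hv => _ _ /andP[].
Qed.

(** Slicing by [q] generic hyperplanes takes [q] off the exponent of the set and
   off the dimension of the subspaces. *)
Lemma generic_bound q k b s u : planar_range b s u ->
  exceptional_bound (q.+1 + k.+1) q.+1 (q%:R + b) s u.
Proof.
elim: q u => [|q IH] u hu; first by rewrite add0r; apply: line_bound.
have [v vu hv] := planar_range_open hu; have [/andP[b0 b2] hs /andP[v0 v1]] := hv.
rewrite addSn; apply: (slice_generic_bound _ _ v1 vu) => //.
  by have := ler0n R q; rewrite -natr1; lra.
have -> : q.+1%:R + b - 1 = q%:R + b by rewrite -natr1; lra.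
exact: IH.
Qed.

(** Each of the [j] projections along lines inside the subspaces costs the
   codimension [k.+1] in the exponent.  Concentrated subspaces only matter at the
   first of them, where [generic_bound] applies with [q.+1] and [b - 1]; the
   resulting exponent [1] is below the claimed one. *)
Lemma projected_bound q k j b s u : planar_range b s u ->
  exceptional_bound ((q + j).+1 + k.+1) (q + j).+1 (q%:R + b) s
    (u + k.+1%:R * j%:R).
Proof.
elim: j u => [|j IH] u hu.
  by rewrite addn0 mulr0 addr0; apply: generic_bound.
have [v vu hv] := planar_range_open hu; have [/andP[b0 b2] hs /andP[v0 v1]] := hv.
have u0 : 0 < u by move: v0; rewrite gt_max => /andP[_ v0]; lra.
rewrite (addnS q j) [(_.+2 + _)%N]addSn.
apply: (project_inside_bound (u := v + k.+1%:R * j%:R) (u' := 1)).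
- by rewrite leq_addr.
- exact: IH.
- move=> s0 hs0; case: (ltP s0 0) => [s0n|s0p].
    by apply: exceptional_bound_empty; rewrite lt_max s0n.
  have j0 : j = 0%N.
    case: j hs0 {IH} => // j; rewrite -natr1 natrD -[j.+1%:R]natr1 => hs0.
    by exfalso; have := ler0n R j; have := ler0n R q; lra.
  subst j; rewrite addn0 in hs0 *.
  have s0b : s0 < b - 1 by move: hs0; rewrite -natr1; lra.
  apply: (@exceptional_bound_le _ _ _ _ _ ((Num.max (2 * s0 - (b - 1)) 0 + 1) / 2)).
    have : Num.max (2 * s0 - (b - 1)) 0 <= 1 by rewrite ge_max; apply/andP; split; lra.
    by lra.
  have -> : q%:R + b = q.+1%:R + (b - 1) by rewrite -natr1; lra.
  rewrite -addSn; apply: generic_bound; split.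
  + by apply/andP; split; lra.
  + by rewrite lt_min; apply/andP; split; lra.
  have : Num.max (2 * s0 - (b - 1)) 0 < 1 by rewrite gt_max; apply/andP; split; lra.
  by move=> h; apply/andP; split; lra.
- rewrite addnC addnK -[j.+1%:R]natr1 mulrDr mulr1; lra.
have : 1 <= k.+1%:R * j.+1%:R :> R by rewrite -natrM ler1n.
by lra.
Qed.

(** The exponent for concentrated subspaces when slicing; it is crude, as the
   projection exponent below 1 makes it much smaller than needed. *)
Lemma below_one_bound N k q b s : (0 < N)%N -> 1 <= b <= 2 -> s < 1 ->
  exceptional_bound (N + k.+1) N (q%:R + b) s (1 + k.+1%:R * (N.-1 - q)%:R).
Proof.
move=> N0 /andP[b1 b2] s1; case: (ltnP q N) => [qN|Nq]; last first.
  apply: exceptional_bound_empty; rewrite lt_max; apply/orP; right.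
  have : N%:R <= q%:R :> R by rewrite ler_nat.
  by lra.
have NE : N = (q + (N.-1 - q)).+1 by move: qN N0; clear; lia.
move: (N.-1 - q)%N NE => j ->.
have mx : Num.max (2 * s - b) 0 < 1 by rewrite gt_max; apply/andP; split; lra.
apply: (exceptional_bound_le (u := (Num.max (2 * s - b) 0 + 1) / 2 +
  k.+1%:R * j%:R)); first by rewrite lerD2r; lra.
apply: projected_bound; split.
- by apply/andP; split; lra.
- by rewrite lt_min s1 andbT; lra.
by apply/andP; split; lra.
Qed.

(** Each of the [l] slices by hyperplanes containing the subspaces costs their
   dimension in the exponent. *)
Lemma sliced_bound l q k j b s u : planar_range b s u ->
  exceptional_bound ((q + j).+1 + k.+1 + l) (q + j).+1 (l%:R + q%:R + b)
    (l%:R + s) (u + (l * (q + j).+1 + k.+1 * j)%:R).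
Proof.
elim: l u => [|l IH] u hu.
  by rewrite addn0 mul0n !add0r add0n natrM; apply: projected_bound.
have [v vu hv] := planar_range_open hu; have [/andP[b0 b2] hs /andP[v0 v1]] := hv.
have u0 : 0 < u by move: v0; rewrite gt_max => /andP[_ v0]; lra.
rewrite addnS.
apply: (slice_containing_bound (u := v + (l * (q + j).+1 + k.+1 * j)%:R)
  (u' := 1 + (k + l).+2%:R * (j - l)%:R)).
- by rewrite -addnA leq_addr.
- have -> : l.+1%:R + q%:R + b - 1 = l%:R + q%:R + b by rewrite -natr1; lra.
  have -> : l.+1%:R + s - 1 = l%:R + s by rewrite -natr1; lra.
  exact: IH.
- move=> s0 s01.
  have nE : ((q + j).+1 + k.+1 + l).+1 = ((q + j).+1 + (k + l).+1.+1)%N by lia.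
  (* The integer part is chosen so that the rest lies between 1 and 2. *)
  rewrite nE; case: (lerP 1 b) => b1.
    have -> : l.+1%:R + q%:R + b = (l + q).+1%:R + b by rewrite -!natr1 natrD; lra.
    apply: exceptional_bound_le; last first.
      by apply: below_one_bound => //; apply/andP; split.
    by rewrite lerD2l ler_wpM2l // ler_nat /=; lia.
  have -> : l.+1%:R + q%:R + b = (l + q)%:R + (b + 1) by rewrite -!natr1 natrD; lra.
  apply: exceptional_bound_le; last first.
    by apply: below_one_bound => //; apply/andP; split; lra.
  by rewrite lerD2l ler_wpM2l // ler_nat /=; lia.
- have -> : (l.+1 * (q + j).+1 + k.+1 * j)%:R =
      (l * (q + j).+1 + k.+1 * j)%:R + (q + j).+1%:R :> R.
    by rewrite -natrD; congr _%:R; rewrite mulSn; lia.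
  by lra.
apply: le_lt_trans (_ : (l.+1 * (q + j).+1 + k.+1 * j)%:R < _); last by lra.
by rewrite -natrM nat1r ler_nat; nia.
Qed.

End Assembly.

(** By the same averaging: a suitable line lies in a [#|F| ^- (n - N)] fraction
   of the subspaces, and these are subspaces of the quotient. *)
Lemma card_grassmannian (R : realFieldType) (F : finFieldType) n N :
  (N <= n)%N ->
  #|grassmannian F n N|%:R <= 4 ^+ N * #|F|%:R ^+ (N * (n - N)) :> R.
Proof.
elim: N n => [|N IH] n Nn.
  rewrite mul0n !expr0 mulr1 (ler_nat R _ 1).
  apply: leq_trans (_ : #|[set (0%VS : {vspace 'rV[F]_n})]| <= 1)%N.
    2: by rewrite cards1.
  apply/subset_leq_card/subsetP => V; rewrite !inE => /eqP d.
  by rewrite -dimv_eq0 d.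
case: n Nn => // n Nn; set E := grassmannian F n.+1 N.+1.
have hE V : V \in E -> (#|F| ^ N.+1).-1%:R / 2 <=
    #|[set v in nonzero (fullv : {vspace 'rV[F]_n.+1}) | v \in V]|%:R :> R.
  rewrite inE => /eqP d; rewrite [X in #|pred_of_set X|](_ : _ = nonzero V).
    by rewrite card_nonzero d; have := ler0n R (#|F| ^ N.+1).-1; lra.
  by apply/setP => v; rewrite !inE memvf andbC.
have [|v vS hv] := pigeonhole _ hE; first by apply: nonzero_gt0; rewrite dim_fullrV.
have v0 := nonzero_neq0 vS; have [M kerM] := quotient_by_line v0.
set E' := [set V in E | v \in V] in hv.
have k1 : #|E|%:R <= 4 * #|F|%:R ^+ (n - N) * #|E'|%:R :> R.
  apply: (nonzero_ratio (ltn0Sn N)) => //; apply: (le_trans hv).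
  by rewrite card_nonzero dim_fullrV addnS subnK.
have k2 : (#|E'| <= #|grassmannian F n N|)%N.
  rewrite -(card_in_imset (f := pushV M)).
    apply/subset_leq_card/subsetP => W /imsetP[V /setIdP[]].
    rewrite !inE => /eqP d vV ->; rewrite -eqSS.
    by rewrite (dim_pushV_mem kerM v0 vV) d.
  move=> U V /setIdP[_ vU] /setIdP[_ vV] e; apply: subv_anti; apply/andP; split.
    by apply: subv_trans (pushV_le kerM e) _; rewrite subv_add subvv.
  by apply: subv_trans (pushV_le kerM (esym e)) _; rewrite subv_add subvv.
apply: (le_trans k1).
apply: le_trans (_ : 4 * #|F|%:R ^+ (n - N) * (4 ^+ N * #|F|%:R ^+ (N * (n - N))) <= _).
  rewrite ler_wpM2l ?mulr_ge0 ?exprn_ge0 //; apply: le_trans (IH n Nn).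
  by rewrite ler_nat.
by rewrite subSS mulSn exprD exprS le_eqVlt; apply/orP; left; apply/eqP; ring.
Qed.

Section Main.
Variable R : realType.
Implicit Types (a s u c eps : R) (n k : nat).

(** The exceptional set itself: [A] is cut down to size about [p `^ a], which
   does not increase its projections, and shaded by itself. *)
Lemma exceptional_le n k a s u c : 0 < a -> 0 < c ->
  exceptional_bound n (n - k) a s u ->
  exists p0 : nat, forall p : nat, prime p -> (p0 <= p)%N ->
    forall A : {set 'rV['F_p]_n}, c * p%:R `^ a <= #|A|%:R ->
    #|exceptional k s A|%:R <= p%:R `^ u.
Proof.
move=> a0 c0 [d d0 [p1 h1]].
have [p2 h2] := powR_large (Num.max 1 (Num.max c (2 / c))) d0.
have [p3 h3] := powR_large c^-1 a0.
exists (maxn p1 (maxn p2 p3)) => p pp; rewrite !geq_max.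
move=> /andP[g1 /andP[g2 g3]] A hA.
have [Q QE] : exists Q : R, Q = p%:R `^ d by eexists; reflexivity.
have [Q1 Qc Q2c] : [/\ 1 <= Q, c <= Q & 2 / c <= Q].
  by have := h2 p g2; rewrite -QE !ge_max => /and3P.
have [X XE] : exists X : R, X = p%:R `^ a by eexists; reflexivity.
have X0 : 0 < X by rewrite XE powR_gt0 // ltr0n prime_gt0.
have cX : 1 <= c * X by rewrite -ler_pdivrMl // mulr1 XE h3.
have cX0 : 0 <= c * X by lra.
have /andP[t1 t2] := truncn_itv cX0; rewrite -natr1 in t2.
have [t tE] : exists t, t = Num.truncn (c * X) by eexists; reflexivity.
rewrite -tE in t1 t2.
have t0 : 1 <= t%:R :> R.
  by rewrite ler1n lt0n; apply: contraTneq cX => t0; rewrite t0 in t2; lra.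
rewrite -XE in hA.
have [A' sA' cA'] : exists2 A' : {set 'rV['F_p]_n}, A' \subset A & #|A'| = t.
  by apply: subset_of_card; rewrite -(ler_nat R); apply: le_trans hA.
apply: (h1 p pp g1 _ (exceptional k s A) A' id (fun=> A')).
rewrite -QE -XE; split=> //.
- rewrite cA'; apply: le_trans (_ : 2 / c * t%:R <= _); last first.
    by rewrite ler_wpM2r // ler0n.
  by rewrite mulrAC ler_pdivlMr // mulrC; lra.
- by rewrite cA'; apply: (le_trans t1); rewrite ler_wpM2r // ltW.
move=> V; rewrite !inE => /andP[/eqP dV hV]; split=> //.
  by rewrite ler_peMl.
apply: le_trans (_ : p%:R `^ s <= _); last by rewrite ler_peMl ?powR_ge0.
apply: le_trans (ltW hV); rewrite ler_nat.
exact/subset_leq_card/imsetS.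
Qed.

(** The two nontrivial types of the Marstrand index at once: [b] is the
   fractional part of [a], increased by one if it is smaller than that of [s],
   so that in both types the planar situation with [b] and [g] remains after
   the reductions. *)
Lemma exceptional_bound_nontrivial n k m l b g eps :
  planar_furstenberg_conjecture R -> (l < k)%N -> (l <= m)%N ->
  (m - l < n - k)%N -> 0 < b <= 2 -> 0 < g -> g <= Num.min b 1 -> 0 < eps ->
  exceptional_bound n (n - k) (m%:R + b) (l%:R + g - eps)
   (eps + (k%:R * (n - k)%:R - (m.+1%:R - l%:R) * (k%:R - l%:R)
     + Num.max (2 * g - b) 0)).
Proof.
move=> furstenberg lk lm mn hb g0; rewrite le_min => /andP[gb g1] e0.
(* Positive and below 1, as the planar conjecture and the generic reductions
   need, and between the planar exponents of [g - eps] and of [g], plus [eps]. *)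
pose u := Num.max (2 * g - b - eps) (Num.min eps 2^-1).
have hu : planar_range b (g - eps) u.
  split=> //; first by rewrite lt_min; apply/andP; split; lra.
  have i0 : 2^-1 < 1 :> R by lra.
  have i1 : 0 < 2^-1 :> R by lra.
  have u1 : u < 1.
    by rewrite /u gt_max gt_min i0 orbT andbT; lra.
  have u0 : 0 < u by rewrite /u lt_max lt_min e0 i1 orbT.
  have u2 : 2 * (g - eps) - b < u.
    by rewrite /u lt_max; apply/orP; left; lra.
  by rewrite gt_max u0 u1 u2.
have [q qE] : exists q, m = (l + q)%N by exists (m - l)%N; rewrite subnKC.
have [j jE] : exists j, (n - k)%N = (q + j).+1.
  by exists (n - k - q.+1)%N; move: mn; rewrite qE; clear; lia.
have [K KE] : exists K, k = (K.+1 + l)%N by exists (k - l.+1)%N; move: lk; clear; lia.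
have nE : n = ((q + j).+1 + K.+1 + l)%N by move: jE; rewrite KE; clear; lia.
have -> : m%:R + b = l%:R + q%:R + b by rewrite qE natrD.
have -> : l%:R + g - eps = l%:R + (g - eps) by lra.
rewrite jE {1}nE.
apply: exceptional_bound_le (sliced_bound furstenberg l q K j hu).
have hmax : u <= eps + Num.max (2 * g - b) 0.
  rewrite /u ge_max; apply/andP; split.
    have : 2 * g - b <= Num.max (2 * g - b) 0 by rewrite le_max lexx.
    by lra.
  have : 0 <= Num.max (2 * g - b) 0 by rewrite le_max lexx orbT.
  have : Num.min eps 2^-1 <= eps by rewrite ge_min lexx.
  by lra.
have -> : (l * (q + j).+1 + K.+1 * j)%:R =
    k%:R * (q + j).+1%:R - (m.+1%:R - l%:R) * (k%:R - l%:R) :> R.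
  rewrite qE KE !(natrD, natrM, =^~ natr1); ring.
by lra.
Qed.

End Main.

Theorem theorem1p11 (R : realType) (furstenberg : planar_furstenberg_conjecture R)
    (n k : nat) (a s : R)
    (hk : (1 <= k)%N) (hkn : (k < n)%N) (ha : 0 < a <= n%:R) (hs : 0 < s) :
  forall c eps : R, 0 < c -> 0 < eps ->
  exists (C : R) (p0 : nat), 0 < C /\
    forall (p : nat), prime p -> (p0 <= p)%N ->
    forall A : {set 'rV['F_p]_n},
      c * p%:R `^ a <= #|A|%:R ->
      ((#|exceptional k (s - eps) A|%:R)%:E
         <= C%:E * powRe p%:R (eps%:E + marstrand a s n k))%E.
Proof.
move=> c eps c0 e0.
have [a0 an] := andP ha.
have from_bound (x : R) : exceptional_bound n (n - k) a (s - eps) (eps + x) ->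
    marstrand a s n k = x%:E -> exists (C : R) (p0 : nat), 0 < C /\
    forall (p : nat), prime p -> (p0 <= p)%N ->
    forall A : {set 'rV['F_p]_n},
      c * p%:R `^ a <= #|A|%:R ->
      ((#|exceptional k (s - eps) A|%:R)%:E
         <= C%:E * powRe p%:R (eps%:E + marstrand a s n k))%E.
  move=> hx ->; have [p0 hp0] := exceptional_le a0 c0 hx.
  exists 1, p0; split=> // p pp pp0 A hA; rewrite mul1e lee_fin.
  exact: hp0.
have NE : (n - k)%:R = n%:R - k%:R :> R by rewrite natrB // ltnW.
have /andP[b0 b1] := fpart_itv a; have /andP[g0 g1] := fpart_itv s.
have ea : a = (ipart a)%:~R + fpart a by rewrite addrC subrK.
have es : s = (ipart s)%:~R + fpart s by rewrite addrC subrK.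
have nat_of (x : R) : 0 < x -> exists m : nat, ipart x = m.
  move=> x0; have : 0 <= ipart x.
    have /andP[_ x1] := fpart_itv x.
    have ex : x = (ipart x)%:~R + fpart x by rewrite addrC subrK.
    move: x1 ex x0; move: (ipart x) (fpart x) => i f f1 -> if0.
    have : 0 < (i + 1)%:~R :> R by rewrite rmorphD /=; lra.
    by rewrite ltr0z ltzD1.
  by case: (ipart x) => // m _; exists m.
have [m mE] := nat_of a a0; have [l lE] := nat_of s hs.
have [hN|hN] := leP s (a - (n - k)%:R).
  have : exceptional_bound n (n - k) a (s - eps) (- 1).
    by apply: exceptional_bound_empty; rewrite lt_max; apply/orP; right; lra.
  move/(exceptional_le a0 c0) => [p0 hp0]; exists 1, p0; split=> // p pp pp0 A hA.
  have /eqP -> : marstrand a s n k == -oo%E by rewrite marstrand_eqNy.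
  have := hp0 p pp pp0 A hA; rewrite powRN powRr1 ?ler0n // => h.
  suff -> : #|exceptional k (s - eps) A| = 0%N by rewrite addeNy /= mule0.
  have p1 : 1 < p%:R :> R by rewrite ltr1n prime_gt1.
  apply/eqP; rewrite -leqn0 -ltnS -(ltr_nat R); apply: (le_lt_trans h).
  by rewrite invf_lt1 // (lt_trans ltr01).
have hNy : marstrand a s n k != -oo%E by rewrite marstrand_eqNy // -ltNge.
have := erefl (marstrand a s n k); rewrite {2}/marstrand mE lE.
case: ifPn => [hs1 mar|].
  exists (4 ^+ (n - k)), 0%N; split; first by rewrite exprn_gt0.
  move=> p pp _ A hA; have p1 : 1 < p%:R :> R by rewrite ltr1n prime_gt1.
  rewrite mar -EFinD /= -EFinM lee_fin.
  apply: le_trans (_ : #|grassmannian 'F_p n (n - k)|%:R <= _).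
    by rewrite ler_nat; apply/subset_leq_card/subsetP => V /setIdP[].
  apply: le_trans (card_grassmannian R _ (leq_subr k n)) _.
  rewrite card_Fp // ler_wpM2l ?exprn_ge0 // -powR_mulrn ?ler0n // subKn ?(ltnW hkn) //.
  rewrite ler_powR ?(ltW p1) // natrM rmorphM rmorphB /= -!pmulrn NE.
  by rewrite mulrC lerDr ltW.
rewrite -leNgt le_min => /andP[sa sk].
rewrite lE -pmulrn in es; rewrite mE -pmulrn in ea.
have lk : (l < k)%N by rewrite -(ltr_nat R); lra.
case: ifPn => [/and3P[lm mn bg]|_].
  case: m mE ea lm mn => [|m] mE ea lm mn mar; first by exfalso; move: lm; clear; lia.
  have hx : exceptional_bound n (n - k) a (s - eps)
      (eps + (k%:R * (n - k)%:R - (m.+1%:R - l%:R) * (k%:R - l%:R)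
      + Num.max (2 * fpart s - (fpart a + 1)) 0)).
    have -> : a = m%:R + (fpart a + 1) by rewrite {1}ea -natr1; lra.
    rewrite {1}es (_ : fpart (m%:R + (fpart a + 1)) = fpart a); last first.
      by congr fpart; rewrite [RHS]ea -natr1; lra.
    apply: exceptional_bound_nontrivial => //.
    - by move: lm; clear; lia.
    - by move: lm mn hkn; clear; lia.
    - by apply/andP; split; lra.
    - by rewrite le_min; apply/andP; split; lra.
  apply: (from_bound _ hx); rewrite mar NE; congr (_%:E); congr (_ + _).
  by rewrite rmorphB !rmorphM !rmorphB /= -!pmulrn.
case: ifPn => [/and3P[lm mn bg] mar|_ mar]; last by rewrite mar eqxx in hNy.
have hx : exceptional_bound n (n - k) a (s - eps)
    (eps + (k%:R * (n - k)%:R - (m.+1%:R - l%:R) * (k%:R - l%:R)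
    + Num.max (2 * fpart s - fpart a) 0)).
  rewrite {1}ea {1}es; apply: exceptional_bound_nontrivial => //.
  - by move: mn hkn; clear; lia.
  - by apply/andP; split; lra.
  - by rewrite le_min; apply/andP; split; lra.
apply: (from_bound _ hx); rewrite mar NE; congr (_%:E); congr (_ + _).
by rewrite rmorphB !rmorphM !rmorphB rmorphD /= -!pmulrn natr1.
Qed.
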